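(* Let $n=2$, and let $s_A$ denote the signature of the real quadratic form $P_A(t)$, the cuspidal form of the planar point configuration $A$. Then, (i) $s_A=(0,0;m)$ if and only if $A$ is a pyramid. (ii) $s_A=(1,0;0)$ if and only if $A$ is contained in a non-real parabola. (iii) $s_A=(0,1;m-1)$ if and only if $A$ is contained in a real parabola. (iv) $s_A=(1,1;m-2)$ if and only if $A$ is contained in a hyperbola. (v) $s_A=(0,2;m-2)$ if and only if $A$ is contained in an ellipse. (vi) $s_A=(1,2;m-3)$ in all other cases.
   Context: Setting. $A$ is a real $3\times N$ matrix of rank $3$ with top row the all ones vector (its columns are not assumed to be distinct), and $\hat A$ is the $2\times N$ matrix obtained by deleting the top row, whose columns $\hat\alpha_1,\dots,\hat\alpha_N\in\mathbb{R}^2$ are the points of the configuration; $m=N-3$ is its codimension. A real Gale dual of $A$ is a real $N\times m$ matrix $B$ of rank $m$ with $AB=0$, with rows $\beta_1,\dots,\beta_N$; write $\langle\beta,t\rangle=\sum_i\beta_it_i$. The cuspidal form is the quadratic form in $t=(t_1,\dots,t_m)$ $$P_A(t)=\sum_{1\le k<l\le N}\det(\hat\alpha_k,\hat\alpha_l)^2\,\langle\beta_k,t\rangle\langle\beta_l,t\rangle .$$ A different choice of real Gale dual changes $P_A$ by a real invertible linear change of the variables $t$, so its signature depends only on $A$. The signature $(p,q;z)$ of a real quadratic form on $\mathbb{R}^m$ records the numbers $p$, $q$, $z$ of positive, negative and zero coefficients in a diagonalization, $p+q+z=m$. Geometric terms. $A$ is a pyramid if all of its points but one are contained in a line. Conics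 are allowed to be degenerate and are given by polynomials $q(x_1,x_2)$ of degree two with degree-two homogeneous part $q_2\neq 0$. A parabola is given by $q$ with $q_2=(ax_1+bx_2)^2$ up to a constant factor, $(a,b)\neq(0,0)$; it is real if $q$ can be taken with real coefficients, and non-real if $q$ has complex coefficients and is not proportional to a real polynomial. A hyperbola is given by a real $q$ with $q_2$ nondegenerate and indefinite, and an ellipse by a real $q$ with $q_2$ definite.
   Formalization: Cases (i)-(vi) are read in order, each excluding the earlier ones, since the geometric conditions overlap; in (ii) the signature is (1,0;m-1) in general and (1,0;0) when the points are distinct; points of a pyramid are counted without multiplicity. *)

(* Defs.v *)
From HB Require Import structures.
From mathcomp Require Import all_boot all_order all_algebra.
From mathcomp Require Import reals.
From mathcomp Require Import complex.
From mathcomp Require Import mpoly.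

Set Implicit Arguments.
Unset Strict Implicit.
Unset Printing Implicit Defensive.

Import Order.TTheory GRing.Theory Num.Theory.
Local Open Scope ring_scope.

Section Configuration.
Variables (R : realType) (N : nat).
Implicit Types A : 'M[R]_(3, N).

Definition planar_config A : Prop :=
  \rank A = 3%N /\ forall j, A ord0 j = 1.

Definition hatA A : 'M[R]_(2, N) := row' ord0 A.

Definition point A (j : 'I_N) : 'cV[R]_2 := col j (hatA A).

(* The points are counted without multiplicity: when a point is the common
   value of several columns, removing it removes all these columns. *)
Definition pyramid A : Prop :=
  exists j : 'I_N, exists a b c : R, (a, b) != (0, 0) /\
    forall k, point A k != point A j ->
      a * point A k 0 0 + b * point A k 1 0 + c = 0.

Definition gale_dual A (m : nat) (B : 'M[R]_(N, m)) : Prop :=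
  \rank B = m /\ A *m B = 0.

Definition cuspidal_form A (m : nat) (B : 'M[R]_(N, m)) (t : 'cV[R]_m) : R :=
  \sum_(k < N) \sum_(l < N | (k < l)%N)
    \det (row_mx (point A k) (point A l) : 'M[R]_2) ^+ 2
      * (\sum_(i < m) B k i * t i 0) * (\sum_(i < m) B l i * t i 0).

End Configuration.

(* Independent of the diagonalization (law of inertia); in particular
   [has_signature F p q z] forces p + q + z = m, so that truncated
   subtractions such as m - 2 in place of z never create spurious signatures. *)
Definition has_signature (R : realType) (m : nat) (F : 'cV[R]_m -> R)
    (p q z : nat) : Prop :=
  exists (T : 'M[R]_m) (d : 'I_m -> R),
    [/\ T \in unitmx,
        forall t, F (T *m t) = \sum_(i < m) d i * t i 0 ^+ 2
      & [/\ #|[set i | 0 < d i]| = p,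
            #|[set i | d i < 0]| = q
          & #|[set i | d i == 0]| = z]].

Section Conics.
Variable K : comNzRingType.
Implicit Types q : {mpoly K[2]}.

(* [msize] is the total degree plus one. *)
Definition conic q : Prop := msize q = 3%N.

Definition quad_part q : {mpoly K[2]} := pihomog mdeg 2 q.

Definition eval_at q (x : 'cV[K]_2) : K := q.@[fun i => x i 0].

Definition parabola q : Prop :=
  conic q /\ exists c a b : K, [/\ c != 0, (a, b) != (0, 0)
    & quad_part q = c *: (a *: 'X_ord0 + b *: 'X_ord_max) ^+ 2].

End Conics.

Section Incidence.
Variable R : realType.

Definition nondegenerate (Q : 'cV[R]_2 -> R) : Prop :=
  forall u, (forall v, Q (u + v) = Q u + Q v) -> u = 0.

Definition indefinite (Q : 'cV[R]_2 -> R) : Prop :=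
  (exists u, 0 < Q u) /\ (exists u, Q u < 0).

Definition definite (Q : 'cV[R]_2 -> R) : Prop :=
  (forall u, u != 0 -> 0 < Q u) \/ (forall u, u != 0 -> Q u < 0).

Definition hyperbola (q : {mpoly R[2]}) : Prop :=
  [/\ conic q, nondegenerate (eval_at (quad_part q))
    & indefinite (eval_at (quad_part q))].

Definition ellipse (q : {mpoly R[2]}) : Prop :=
  conic q /\ definite (eval_at (quad_part q)).

Definition proportional_to_real (q : {mpoly (complex R)[2]}) : Prop :=
  exists (c : complex R) (r : {mpoly R[2]}),
    c != 0 /\ q = c *: map_mpoly (real_complex R) r.

Variables (N : nat) (A : 'M[R]_(3, N)).

Definition lies_on (q : {mpoly R[2]}) : Prop :=
  forall j, eval_at q (point A j) = 0.

Definition lies_on_complex (q : {mpoly (complex R)[2]}) : Prop :=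
  forall j, eval_at q (map_mx (real_complex R) (point A j)) = 0.

Definition in_nonreal_parabola : Prop :=
  exists q : {mpoly (complex R)[2]},
    [/\ parabola q, ~ proportional_to_real q & lies_on_complex q].

Definition in_real_parabola : Prop :=
  exists q : {mpoly (complex R)[2]},
    [/\ parabola q, proportional_to_real q & lies_on_complex q].

Definition in_hyperbola : Prop :=
  exists q : {mpoly R[2]}, hyperbola q /\ lies_on q.

Definition in_ellipse : Prop :=
  exists q : {mpoly R[2]}, ellipse q /\ lies_on q.

End Incidence.

(* Main.v *)
Require Import Defs.
From HB Require Import structures.
From mathcomp Require Import all_boot all_order all_algebra.
From mathcomp Require boolp.
From mathcomp Require Import reals.
From mathcomp Require Import complex.
From mathcomp Require Import mpoly.
From mathcomp Require Import ring lra.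

Set Implicit Arguments.
Unset Strict Implicit.
Unset Printing Implicit Defensive.

Import Order.TTheory GRing.Theory Num.Theory.
Local Open Scope ring_scope.

(* With X, Y, Z the linear forms sum x_k^2 w_k, sum y_k^2 w_k, sum x_k y_k w_k in
   w = B t, the cuspidal form is X Y - Z^2, and by Gale duality a relation
   a X + b Y + c Z = 0 holds exactly when the points lie on a conic with
   quadratic part a x^2 + b y^2 + c x y.  So P_A is the restriction of a form of
   signature (1,2) to the space cut out by these relations, and each type of
   conic determines the signature: by exhaustiveness of the geometric cases and
   the law of inertia, the implications "geometry => signature" suffice.
   P_A vanishes only if the space lies in an isotropic line, which forces a
   pyramid.  If the space has dimension one, its points (r, s, p) give a complex
   parabola, with (a, b) a root of r a^2 + s b^2 + 2 p a b. *)

(** * Signatures and the law of inertia *)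

Section Inertia.
Variable R : realType.

(** On the coefficients (a, b, c) of relations, the inverse of the form X Y - Z^2 is 4 a b - c^2. So
    the discriminant of a conic decides the signature on the plane that its relation cuts out, and
    parabolas, of coefficients (a^2, b^2, 2 a b), are the tangent case. The obstacle is that a conic
    bounds the space of values (X, Y, Z) only from outside: this space may be smaller than the
    plane, and then the conic does not fix the signature. Hence the alternative
    [proportional_forms], and hence the exclusion of parabolas in the hyperbola and ellipse cases: a
    space of dimension at most one always satisfies a complex relation of parabola type, because a
    binary quadratic form has a complex root. *)

Lemma not_row_free_relation r m (L : 'M[R]_(r, m)) :
  ~~ row_free L -> exists2 u : 'rV_r, u != 0 & u *m L = 0.
Proof.
rewrite -kermx_eq0 => /rowV0Pn[u /sub_kermxP uL0 u0]; by exists u.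
Qed.

Lemma has_signature_total m (F : 'cV[R]_m -> R) p q z :
  has_signature F p q z -> (p + q + z)%N = m.
Proof.
case=> T [d [_ _ [<- <- <-]]].
rewrite -[RHS]card_ord -!sum1_card big_mkcond [X in (_ + X + _)%N]big_mkcond.
rewrite [X in (_ + X)%N]big_mkcond -!big_split /=.
by apply: eq_bigr => i _; rewrite !inE; case: ltgtP.
Qed.

(* The span of the positive directions of [T] and that of the nonpositive
   directions of [T'] meet only in 0. *)
Lemma has_signature_pos_le m (F : 'cV[R]_m -> R) p q z p' q' z' :
  has_signature F p q z -> has_signature F p' q' z' -> (p <= p')%N.
Proof.
case=> T [d [Tu FT [<- _ _]]] [T' [d' [Tu' FT' [<- _ _]]]].
set I := [set i | 0 < d i]; set J := [set i | 0 < d' i].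
rewrite leqNgt; apply/negP => JI.
(* The rows of [K] are the equations of both subspaces, written in the coordinates of [T]. Since J
   is smaller than I there are fewer than [m] of them, so they have a common nonzero solution. *)
pose K := col_mx (rowsub (@enum_val _ (mem (~: I))) (1%:M : 'M[R]_m))
            (rowsub (@enum_val _ (mem J)) (invmx T' *m T)).
have rK : (\rank K^T < m)%N.
  rewrite mxrank_tr; apply: leq_ltn_trans (rank_leq_row _) _.
  by rewrite cardsCs setCK card_ord; have := max_card (mem I);
     rewrite card_ord => Im; rewrite -ltn_subRL subKn.
have [|u u0 uK] := @not_row_free_relation _ _ K^T.
  by rewrite /row_free neq_ltn rK.
have {}uK : K *m u^T = 0 by rewrite -[K]trmxK -trmx_mul uK trmx0.
have uI i : i \notin I -> u 0 i = 0.
  move=> iI; have iI' : i \in ~: I by rewrite in_setC.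
  have /colP/(_ (lshift _ (enum_rank_in iI' i))) := uK.
  rewrite mul_col_mx col_mxEu mul_rowsub_mx mul1mx !mxE enum_rankK_in //.
pose v := invmx T' *m T *m u^T.
have vJ i : i \in J -> v i 0 = 0.
  move=> iJ.
  have /colP/(_ (rshift _ (enum_rank_in iJ i))) := uK.
  by rewrite mul_col_mx col_mxEd mul_rowsub_mx !mxE enum_rankK_in.
have := FT u^T; have -> : T *m u^T = T' *m v by rewrite !mulmxA mulmxV ?mul1mx.
rewrite FT'; apply/eqP; rewrite lt_eqF //.
apply: (@le_lt_trans _ _ 0).
  apply: sumr_le0 => i _; have [iJ|] := boolP (i \in J).
    by rewrite vJ // expr0n mulr0.
  by rewrite inE -leNgt => di; rewrite mulr_le0_ge0 ?sqr_ge0.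
have /rV0Pn[i ui] := u0.
have iI : i \in I by apply: contraNT ui => /uI ->.
rewrite (bigD1 i) //= ltr_pwDl //.
  by rewrite mxE mulr_gt0 ?exprn_even_gt0 //; rewrite inE in iI.
apply: sumr_ge0 => k _; have [|/uI uk] := boolP (k \in I).
  by rewrite inE => dk; rewrite mulr_ge0 ?sqr_ge0 ?ltW.
by rewrite mxE uk expr0n mulr0.
Qed.

Lemma has_signatureN m (F : 'cV[R]_m -> R) p q z :
  has_signature F p q z -> has_signature (fun t => - F t) q p z.
Proof.
case=> T [d [Tu FT [<- <- <-]]]; exists T, (fun i => - d i); split=> //.
  by move=> t; rewrite FT -sumrN; apply: eq_bigr => i _; rewrite mulNr.
by split; apply: eq_card => i; rewrite !inE ?oppr_gt0 ?oppr_lt0 ?oppr_eq0.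
Qed.

(** The bound on positive coefficients, used in both directions, is applied to [F] and to its
    opposite. *)
Lemma has_signature_unique m (F : 'cV[R]_m -> R) p q z p' q' z' :
  has_signature F p q z -> has_signature F p' q' z' -> (p, q) = (p', q').
Proof.
move=> s s'; congr (_, _); apply/eqP; rewrite eqn_leq.
  by rewrite (has_signature_pos_le s s') (has_signature_pos_le s' s).
rewrite (has_signature_pos_le (has_signatureN s) (has_signatureN s')).
by rewrite (has_signature_pos_le (has_signatureN s') (has_signatureN s)).
Qed.

Definition lform m (u : 'rV[R]_m) (t : 'cV[R]_m) : R := (u *m t) 0 0.

Lemma lformD m (u v : 'rV[R]_m) t : lform (u + v) t = lform u t + lform v t.
Proof. by rewrite /lform mulmxDl mxE. Qed.

Lemma lformZ m a (u : 'rV[R]_m) t : lform (a *: u) t = a * lform u t.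
Proof. by rewrite /lform -scalemxAl mxE. Qed.

Lemma lform0 m (t : 'cV[R]_m) : lform 0 t = 0.
Proof. by rewrite /lform mul0mx mxE. Qed.

Definition row_stack m (us : seq 'rV[R]_m) : 'M[R]_(size us, m) :=
  \matrix_i us`_i.

Lemma count_nth_ord (s : seq R) (a : pred R) r (d : 'I_(r) -> R) :
  size s = r -> (forall i : 'I_r, d i = s`_i) -> #|[set i | a (d i)]| = count a s.
Proof.
move=> sr dE; subst r; rewrite -sum1_card -sum1_count (big_nth 0) big_mkord.
by apply: eq_bigl => i; rewrite inE dE.
Qed.

(** Independent forms extend to a full system of coordinates, and the added coordinates get
    coefficient zero. Signatures are then obtained by writing [F] as a combination of squares of
    independent forms. *)
Lemma has_signature_forms m (F : 'cV[R]_m -> R) (us : seq 'rV[R]_m)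
    (ds : seq R) :
  size ds = size us -> row_free (row_stack us) -> all (fun d => d != 0) ds ->
  (forall t, F t = \sum_(i < size us) ds`_i * lform us`_i t ^+ 2) ->
  has_signature F (count (fun d => 0 < d) ds) (count (fun d => d < 0) ds)
    (m - size us).
Proof.
set L := row_stack us => sds Lf ds0 FE.
have rm : (size us <= m)%N by rewrite -(eqP Lf) rank_leq_col.
have FL t : F t = \sum_(i < size us) ds`_i * (L *m t) i 0 ^+ 2.
  rewrite FE; apply: eq_bigr => i _; congr (_ * _ ^+ 2).
  by rewrite /lform -[us`_i](rowK (fun i => us`_i)) -row_mul mxE.
move: L Lf FL; move: (size us) rm sds => r rm sds L Lf FL {FE}.
have [k mE] : exists k, m = (r + k)%N by exists (m - r)%N; rewrite subnKC.
subst m; rewrite addKn.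
(* In the factorization of [L] by [col_ebase] and [row_ebase], full row rank turns the middle factor
   into an identity block beside zeros. Absorbing [col_ebase L] into the other factor gives an
   invertible [W] whose first [r] rows are [L]. *)
pose W := block_mx (col_ebase L) 0 0 1%:M *m row_ebase L.
have Wu : W \in unitmx.
  by rewrite unitmx_mul row_ebase_unit unitmxE det_ublock det1 mulr1
    -unitmxE col_ebase_unit.
have LW : L = row_mx 1%:M 0 *m W.
  rewrite mulmxA mul_row_block !mul1mx !mul0mx !addr0.
  rewrite -[L in LHS]mulmx_ebase (eqP Lf) pid_mx_row; congr (_ *m _).
  by rewrite mul_mx_row mulmx1 mulmx0.
have FT t : F (invmx W *m t) = \sum_(i < r) ds`_i * t (lshift k i) 0 ^+ 2.
  rewrite FL LW -mulmxA mulKVmx //; apply: eq_bigr => i _.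
  by rewrite -[t in LHS]vsubmxK mul_row_col mul1mx mul0mx addr0 mxE.
pose d (i : 'I_(r + k)) := (ds ++ nseq k 0)`_i.
have sd : size (ds ++ nseq k (0 : R)) = (r + k)%N by rewrite size_cat size_nseq sds.
exists (invmx W), d; split; first by rewrite unitmx_inv.
  move=> t; rewrite FT big_split_ord /= [X in _ + X]big1 ?addr0; last first.
    move=> i _; rewrite /d nth_cat sds /= ltnNge leq_addr /= nth_nseq.
    by rewrite if_same mul0r.
  by apply: eq_bigr => i _; rewrite /d nth_cat sds /= ltn_ord.
have dE i : d i = (ds ++ nseq k 0)`_i by [].
split.
- rewrite (count_nth_ord (fun x => 0 < x) sd dE) count_cat count_nseq /= ltxx.
  by rewrite addn0.
- rewrite (count_nth_ord (fun x => x < 0) sd dE) count_cat count_nseq /= ltxx.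
  by rewrite addn0.
rewrite (count_nth_ord (fun x => x == 0) sd dE) count_cat count_nseq /= eqxx mul1n.
suff -> : count (fun x => x == 0) ds = 0%N by [].
by apply/count_memPn/negP => /(allP ds0); rewrite eqxx.
Qed.

End Inertia.

(** * The form X Y - Z^2 under linear relations *)

Section PulledBackForm.
Variables (R : realType) (m : nat).
Implicit Types (F : 'cV[R]_m -> R) (u v X Y Z : 'rV[R]_m).

Lemma mul_row_stack (us : seq 'rV[R]_m) (w : 'rV_(size us)) :
  w *m row_stack us = \sum_(i < size us) w 0 i *: us`_i.
Proof. by rewrite mulmx_sum_row; apply: eq_bigr => i _; rewrite rowK. Qed.

Lemma has_signature_zero F : (forall t, F t = 0) -> has_signature F 0 0 m.
Proof.
move=> F0; rewrite -[X in has_signature _ _ _ X]subn0.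
apply: (@has_signature_forms _ _ _ [::] [::]) => //; first by rewrite /row_free mxrank.unlock.
by move=> t; rewrite big_ord0 F0.
Qed.

(** That [F] does not vanish makes [v] nonzero, hence independent. The booleans count as 0 or 1, so
    one statement serves both signs of [d]. *)
Lemma has_signature_square F d v : d != 0 ->
  (forall t, F t = d * lform v t ^+ 2) -> ~ (forall t, F t = 0) ->
  has_signature F (0 < d)%R (d < 0)%R (m - 1).
Proof.
move=> d0 FE F0.
have -> : nat_of_bool (0 < d)%R = count (fun d => 0 < d) [:: d] by rewrite /= addn0.
have -> : nat_of_bool (d < 0)%R = count (fun d => d < 0) [:: d] by rewrite /= addn0.
apply: (@has_signature_forms _ _ _ [:: v]) => //; last 2 first.
- by rewrite /= d0.
- by move=> t; rewrite big_ord_recl big_ord0 addr0 FE /=.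
apply/negPn/negP => /not_row_free_relation[w w0].
rewrite mul_row_stack big_ord_recl big_ord0 addr0 /= => wv0; apply: F0 => t.
have wn0 : w 0 ord0 != 0.
  by apply: contraNneq w0 => w0; apply/eqP/rowP => i; rewrite ord1 w0 mxE.
have/eqP := wv0; rewrite scaler_eq0 (negPf wn0) /= => /eqP v0.
by rewrite FE v0 lform0 expr0n mulr0.
Qed.

Lemma two_forms u v :
  row_free (row_stack [:: u; v]) \/
  exists l a b, u = a *: l /\ v = b *: l.
Proof.
have [|/not_row_free_relation[w w0]] := boolP (row_free _); first by left.
rewrite mul_row_stack !big_ord_recl big_ord0 addr0 /=.
set a := w _ _; set b := w _ _ => wE; right.
have [b0|b0] := eqVneq b 0.
  have a0 : a != 0.
    apply: contraNneq w0 => a0; apply/eqP/rowP; case=> -[|[|//]] i.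
      by rewrite mxE -[RHS]a0; congr (w _ _); apply: val_inj.
    by rewrite mxE -[RHS]b0; congr (w _ _); apply: val_inj.
  exists v, 0, 1; rewrite scale1r scale0r; split=> //.
  by move/eqP: wE; rewrite b0 scale0r addr0 scaler_eq0 (negPf a0) => /eqP.
exists u, 1, (- (b^-1 * a)); rewrite scale1r; split=> //.
move/eqP: wE; rewrite addrC addr_eq0 => /eqP wE.
by rewrite scaleNr -scalerA -scalerN -wE scalerA mulVf // scale1r.
Qed.

(** The vectors (X t, Y t, Z t) span a space of dimension at most one; [l] and the coefficients may
    vanish. *)
Definition proportional_forms X Y Z :=
  exists (l : 'rV[R]_m) (r s p : R), [/\ X = r *: l, Y = s *: l & Z = p *: l].

Lemma lform_relation X Y Z a b c t : a *: X + b *: Y + c *: Z = 0 ->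
  a * lform X t + b * lform Y t + c * lform Z t = 0.
Proof. by move=> /(congr1 (fun u => lform u t)); rewrite !lformD !lformZ lform0. Qed.

(** Solving the relation for X and completing the square gives X Y - Z^2 = - (a Z + (c/2) Y)^2 / a^2
    - (4 a b - c^2) Y^2 / (4 a^2). One square is always negative, whence the successor; the
    discriminant gives the sign of the other. *)
Lemma signature_plane_l F X Y Z a b c :
  (forall t, F t = lform X t * lform Y t - lform Z t ^+ 2) ->
  a *: X + b *: Y + c *: Z = 0 -> a != 0 -> 4 * a * b - c ^+ 2 != 0 ->
  has_signature F (4 * a * b < c ^+ 2)%R (c ^+ 2 < 4 * a * b)%R.+1 (m - 2) \/
  proportional_forms X Y Z.
Proof.
move=> FE rel a0 D0.
have a2 : 0 < a ^+ 2 by rewrite exprn_even_gt0.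
case: (two_forms (a *: Z + (c / 2) *: Y) Y) => [free|[l [r [s [ZE YE]]]]].
  left; pose ds := [:: - a ^- 2; - (4 * a * b - c ^+ 2) / (4 * a ^+ 2)].
  have ds0 : (- a ^- 2 < 0) by rewrite oppr_lt0 invr_gt0.
  have e1 : (4 * a * b < c ^+ 2) = (0 < - (4 * a * b - c ^+ 2) / (4 * a ^+ 2)).
    by rewrite pmulr_lgt0 ?oppr_gt0 ?subr_lt0 // invr_gt0 mulr_gt0.
  have e2 : (c ^+ 2 < 4 * a * b) = (- (4 * a * b - c ^+ 2) / (4 * a ^+ 2) < 0).
    by rewrite pmulr_llt0 ?oppr_lt0 ?subr_gt0 // invr_gt0 mulr_gt0.
  have -> : nat_of_bool (4 * a * b < c ^+ 2)%R = count (fun d => 0 < d) ds.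
    by rewrite e1 /= addn0 (lt_gtF ds0).
  have -> : (c ^+ 2 < 4 * a * b)%R.+1 = count (fun d => d < 0) ds.
    by rewrite e2 /= addn0 ds0.
  apply: (has_signature_forms _ free) => //=.
    rewrite andbT lt_eqF //= mulf_neq0 ?oppr_eq0 // invr_neq0 //.
    by rewrite gt_eqF // mulr_gt0.
  move=> t; rewrite FE !big_ord_recl big_ord0 addr0 /= lformD !lformZ.
  have := lform_relation t rel; set x := lform X t; set y := lform Y t.
  set z := lform Z t => E; have -> : x = - (b * y + c * z) / a.
    apply: (mulfI a0); apply/eqP; rewrite mulrCA divff // mulr1.
    by rewrite -addr_eq0 addrA E.
  by field.
right; have ZE' : Z = (a^-1 * (r - c / 2 * s)) *: l.
  apply: (scalerI a0); rewrite scalerA mulrA divff // mul1r scalerBl -ZE YE scalerA.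
  by rewrite addrK.
exists l, (- a^-1 * (b * s + c * (a^-1 * (r - c / 2 * s)))), s,
  (a^-1 * (r - c / 2 * s)); split=> //.
apply: (scalerI a0).
have -> : a *: X = - (b *: Y + c *: Z) by apply/eqP; rewrite -addr_eq0 addrA rel.
by rewrite YE ZE' !scalerA -scalerDl -scaleNr; congr (_ *: _); field.
Qed.

(** The roles of X and Y are exchanged when only [b] is nonzero. If both [a] and [b] vanish, the
    relation is Z = 0 and X Y = ((X + Y)^2 - (X - Y)^2) / 4 replaces the completed square. *)
Lemma signature_plane F X Y Z a b c :
  (forall t, F t = lform X t * lform Y t - lform Z t ^+ 2) ->
  a *: X + b *: Y + c *: Z = 0 -> 4 * a * b - c ^+ 2 != 0 ->
  has_signature F (4 * a * b < c ^+ 2)%R (c ^+ 2 < 4 * a * b)%R.+1 (m - 2) \/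
  proportional_forms X Y Z.
Proof.
move=> FE rel D0.
have [a0|a0] := eqVneq a 0; last exact: signature_plane_l rel a0 D0.
have [b0|b0] := eqVneq b 0; last first.
  rewrite mulrAC; case: (@signature_plane_l F Y X Z b a c) => //; first last.
  - by move=> [l [r [s [p [YE XE ZE]]]]]; right; exists l, s, r, p.
  - by left.
  - by rewrite mulrAC.
  - by rewrite [b *: _ + _]addrC.
  - by move=> t; rewrite FE mulrC.
have c0 : c != 0.
  by apply: contraNneq D0 => ->; rewrite a0 mulr0 mul0r expr0n subr0.
have Z0 : Z = 0.
  move/eqP: rel; rewrite a0 b0 !scale0r !add0r scaler_eq0 (negPf c0) /=.
  by move/eqP.
rewrite a0 mulr0 mul0r exprn_even_gt0 //= c0 [_ < 0]lt_gtF ?exprn_even_gt0 //.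
case: (two_forms (X + Y) (X - Y)) => [free|[l [r [s [E1 E2]]]]].
  left; pose ds := [:: 1 / 4; - (1 / 4)] : seq R.
  have p4 : 0 < 1 / 4 :> R by rewrite divr_gt0.
  have n4 : - (1 / 4) < 0 :> R by rewrite oppr_lt0.
  have := has_signature_forms (F := F) (ds := ds) _ free.
  rewrite /= p4 n4 (lt_gtF p4) (lt_gtF n4); apply=> //.
    by rewrite gt_eqF //= lt_eqF.
  move=> t; rewrite FE !big_ord_recl big_ord0 addr0 /= -scaleN1r !lformD lformZ.
  by rewrite Z0 lform0; field.
right; have two0 : 2 != 0 :> R by rewrite pnatr_eq0.
exists l, ((r + s) / 2), ((r - s) / 2), 0; split; last by rewrite scale0r.
  apply: (scalerI two0); rewrite scalerA mulrCA (divff two0) mulr1 [RHS]scalerDl.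
  by rewrite -E1 -E2 addrACA subrr addr0 scaler_nat mulr2n.
apply: (scalerI two0); rewrite scalerA mulrCA (divff two0) mulr1 scalerBl.
by rewrite -E1 -E2 opprB [X + Y]addrC addrACA subrr addr0 scaler_nat mulr2n.
Qed.

(** X Y - Z^2 is ((X + Y)^2 - (X - Y)^2) / 4 - Z^2. A dependency between these three forms is also
    one between X, Y and Z. *)
Lemma signature_space F X Y Z :
  (forall t, F t = lform X t * lform Y t - lform Z t ^+ 2) ->
  has_signature F 1 2 (m - 3) \/
  exists a b c, (a, b, c) != (0, 0, 0) /\ a *: X + b *: Y + c *: Z = 0.
Proof.
move=> FE; pose us := [:: X + Y; X - Y; Z].
have [free|/not_row_free_relation[w w0]] := boolP (row_free (row_stack us)).
  left; pose ds := [:: 1 / 4; - (1 / 4); -1] : seq R.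
  have p4 : 0 < 1 / 4 :> R by rewrite divr_gt0.
  have n4 : - (1 / 4) < 0 :> R by rewrite oppr_lt0.
  have n1 : -1 < 0 :> R by rewrite oppr_lt0.
  have := has_signature_forms (F := F) (ds := ds) _ free.
  rewrite /= p4 n4 n1 (lt_gtF p4) (lt_gtF n4) (lt_gtF n1); apply=> //.
    by rewrite gt_eqF //= !lt_eqF.
  move=> t; rewrite FE !big_ord_recl big_ord0 addr0 /= -scaleN1r !lformD lformZ.
  by field.
rewrite mul_row_stack !big_ord_recl big_ord0 addr0 /=.
set w0' := w _ _; set w1 := w _ _; set w2 := w _ _ => wE; right.
exists (w0' + w1), (w0' - w1), w2; split; last first.
  rewrite -[RHS]wE addrA; congr (_ + _); rewrite scalerDl scalerDr scalerBl scalerBr.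
  by rewrite addrACA.
apply: contraNneq w0 => -[e1 e2 e3].
have w00 : w0' = 0 by lra.
have w10 : w1 = 0 by lra.
apply/eqP/rowP; case=> -[|[|[|//]]] i; rewrite mxE.
- by rewrite -[RHS]w00; congr (w _ _); apply: val_inj.
- by rewrite -[RHS]w10; congr (w _ _); apply: val_inj.
- by rewrite -[RHS]e3; congr (w _ _); apply: val_inj.
Qed.

(** Isotropic vectors are the multiples of (p^2, q^2, p q), and the two equations say that all
    values lie on one such line. *)
Lemma isotropic_forms X Y Z :
  (forall t, lform X t * lform Y t - lform Z t ^+ 2 = 0) ->
  exists p q : R, [/\ (p, q) != (0, 0), q *: X = p *: Z & q *: Z = p *: Y].
Proof.
move=> iso.
have formP (u v : 'rV[R]_m) : (forall t, lform u t = lform v t) -> u = v.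
  move=> uv; apply/rowP => j; have := uv (delta_mx j 0).
  by rewrite /lform -!colE !mxE.
have lformDr u t s : lform u (t + s) = lform u t + lform u s.
  by rewrite /lform mulmxDr mxE.
have lformZr u k t : lform u (k *: t) = k * lform u t.
  by rewrite /lform -scalemxAr mxE.
have [X0|X0] := eqVneq X 0.
  exists 0, 1; split; rewrite ?scale1r ?scale0r //.
    by rewrite xpair_eqE oner_eq0 andbF.
  apply: formP => t; have := iso t; rewrite X0 !lform0 mul0r sub0r.
  by move/eqP; rewrite oppr_eq0 expf_eq0 /= => /eqP.
have /rV0Pn[j Xj] := X0; pose s := delta_mx j 0 : 'cV[R]_m.
have Xs : lform X s != 0 by rewrite /lform -colE mxE.
(* The form X vanishes at X(s) t - X(t) s, so isotropy makes Z vanish there too. *)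
have ZX t : lform Z s * lform X t = lform X s * lform Z t.
  have := iso (lform X s *: t + (- lform X t) *: s).
  rewrite !lformDr !lformZr.
  have -> : lform X s * lform X t + - lform X t * lform X s = 0 by ring.
  rewrite mul0r sub0r; move/eqP; rewrite oppr_eq0 expf_eq0 /= => /eqP E.
  by lra.
(* On the line of (p^2, q^2, p q), the ratio of X to Z is p : q. *)
exists (lform X s), (lform Z s); split.
- by rewrite xpair_eqE negb_and Xs.
- by apply: formP => t; rewrite !lformZ ZX.
apply: formP => t; rewrite !lformZ.
have := iso (t + s); rewrite !lformDr; have := iso t; have := iso s.
have := ZX t.
set xs := lform X s in Xs *; set xt := lform X t; set ys := lform Y s.
set yt := lform Y t; set zs := lform Z s; set zt := lform Z t => e1 e2 e3 e4.
apply: (mulfI Xs).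
have e5 : xs * yt + xt * ys = 2 * (zs * zt) by move: e2 e3 e4; lra.
have -> : xs * (xs * yt) = xs * (xs * yt + xt * ys)
    - xt * (xs * ys - zs ^+ 2) - xt * zs ^+ 2 by ring.
rewrite e5 e2; have -> : xt * zs ^+ 2 = zs * (zs * xt) by ring.
by rewrite e1; ring.
Qed.

End PulledBackForm.

(** * Polynomials of plane conics *)

Section ConicPolynomials.
Variable K : comNzRingType.
Implicit Types q : {mpoly K[2]}.

Lemma mnm2_eq (m m' : 'X_{1..2}) :
  (m == m') = (m ord0 == m' ord0) && (m ord_max == m' ord_max).
Proof.
apply/eqP/andP => [-> //|[/eqP e0 /eqP e1]]; apply/mnmP; case=> -[|[|//]] i.
  by move: e0; congr (m _ = m' _); apply: val_inj.
by move: e1; congr (m _ = m' _); apply: val_inj.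
Qed.

Lemma mdeg2E (m : 'X_{1..2}) : mdeg m = (m ord0 + m ord_max)%N.
Proof.
rewrite mdegE !big_ord_recl big_ord0 addn0; congr (_ + m _)%N; exact: val_inj.
Qed.

Lemma mcoeff_quad_part q m : (quad_part q)@_m = q@_m *+ (mdeg m == 2%N).
Proof.
rewrite /quad_part pihomogE raddf_sum /= [q in RHS]mpolyE raddf_sum /=.
rewrite -sumrMnl big_mkcond /=; apply: eq_bigr => k _.
rewrite mcoeffZ mcoeffX; have [->|] := eqVneq k m.
  by case: ifP; rewrite ?mcoeffZ ?mcoeffX ?eqxx.
by move=> /negPf km; case: ifP; rewrite ?mcoeffZ ?mcoeffX ?km ?mulr0 mul0rn.
Qed.

Definition conic_poly (a b c d e g : K) : {mpoly K[2]} :=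
  a *: 'X_ord0 ^+ 2 + b *: 'X_ord_max ^+ 2 + c *: ('X_ord0 * 'X_ord_max)
    + d *: 'X_ord0 + e *: 'X_ord_max + g%:MP.

(** Polynomial identities between conics are checked on coefficients, by cases on the two
    exponents. *)
Lemma mcoeff_conic_poly a b c d e g (m : 'X_{1..2}) :
  (conic_poly a b c d e g)@_m =
    a *+ ((m ord0 == 2%N) && (m ord_max == 0%N))
    + b *+ ((m ord0 == 0%N) && (m ord_max == 2%N))
    + c *+ ((m ord0 == 1%N) && (m ord_max == 1%N))
    + d *+ ((m ord0 == 1%N) && (m ord_max == 0%N))
    + e *+ ((m ord0 == 0%N) && (m ord_max == 1%N))
    + g *+ ((m ord0 == 0%N) && (m ord_max == 0%N)).
Proof.
rewrite /conic_poly -mpolyXD !mcoeffD !mcoeffZ mcoeffC !mcoeffXn !mcoeffX.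
rewrite !mulr_natr !mnm2_eq !mulmnE !mnmDE !mnmE /=.
by rewrite ![m _ == _]eq_sym.
Qed.

Lemma conic_polyE q : (msize q <= 3)%N ->
  exists a b c d e g, q = conic_poly a b c d e g.
Proof.
move=> q3; pose M i j : 'X_{1..2} := (U_(ord0) *+ i + U_(ord_max) *+ j)%MM.
have M0 i j : M i j ord0 = i by rewrite mnmDE !mulmnE !mnmE /= mul1n mul0n addn0.
have M1 i j : M i j ord_max = j by rewrite mnmDE !mulmnE !mnmE /= mul1n mul0n.
exists q@_(M 2 0), q@_(M 0 2), q@_(M 1 1), q@_(M 1 0), q@_(M 0 1), q@_(M 0 0)%N.
apply/mpolyP => m; rewrite mcoeff_conic_poly.
have -> : m = M (m ord0) (m ord_max) by apply/eqP; rewrite mnm2_eq M0 M1 !eqxx.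
clearbody M; rewrite !M0 !M1; have [le3|] := leqP 3 (mdeg m).
  rewrite memN_msupp_eq0; last first.
    by apply: msize_mdeg_ge; rewrite mdeg2E M0 M1 -mdeg2E (leq_trans q3).
  move: le3; rewrite mdeg2E; case: (m ord0) => [|[|[|i]]];
    case: (m ord_max) => [|[|[|j]]] //= _;
  move: (q@_(M 2 0)) (q@_(M 0 2)) (q@_(M 1 1)) (q@_(M 1 0)) (q@_(M 0 1)) (q@_(M 0 0))%N => *;
  by rewrite !mulr0n !addr0.
rewrite mdeg2E; case: (m ord0) => [|[|[|i]]];
    case: (m ord_max) => [|[|[|j]]] //= _;
  move: (q@_(M 2 0)) (q@_(M 0 2)) (q@_(M 1 1)) (q@_(M 1 0)) (q@_(M 0 1)) (q@_(M 0 0))%N => *;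
  by rewrite ?mulr0n ?mulr1n ?addr0 ?add0r.
Qed.

Lemma quad_part_conic_poly a b c d e g :
  quad_part (conic_poly a b c d e g) = conic_poly a b c 0 0 0.
Proof.
apply/mpolyP => m; rewrite mcoeff_quad_part !mcoeff_conic_poly mdeg2E.
case: (m ord0) => [|[|[|i]]]; case: (m ord_max) => [|[|[|j]]] //=;
  by rewrite ?mulr0n ?mulr1n ?addr0 ?add0r ?mul0rn.
Qed.

Lemma conic_conic_poly a b c d e g :
  (a, b, c) != (0, 0, 0) -> conic (conic_poly a b c d e g).
Proof.
move=> abc0; apply/eqP; rewrite eqn_leq; apply/andP; split.
  rewrite msizeE; apply/bigmax_leqP_seq => m + _.
  rewrite mcoeff_msupp mcoeff_conic_poly mdeg2E.
  case: (m ord0) => [|[|[|i]]]; case: (m ord_max) => [|[|[|j]]] //=;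
    by rewrite ?mulr0n ?addr0 ?eqxx.
rewrite leqNgt ltnS; apply: contra abc0 => q2.
pose M i j : 'X_{1..2} := (U_(ord0) *+ i + U_(ord_max) *+ j)%MM.
have M0 i j : M i j ord0 = i by rewrite mnmDE !mulmnE !mnmE /= mul1n mul0n addn0.
have M1 i j : M i j ord_max = j by rewrite mnmDE !mulmnE !mnmE /= mul1n mul0n.
have E i j : (i + j)%N = 2%N -> (conic_poly a b c d e g)@_(M i j) = 0.
  move=> ij; apply: memN_msupp_eq0; apply: msize_mdeg_ge.
  by rewrite mdeg2E M0 M1 ij.
move: (E 2 0 erefl)%N (E 0 2 erefl)%N (E 1 1 erefl)%N.
rewrite !mcoeff_conic_poly !M0 !M1 /= !mulr0n !mulr1n ?addr0 ?add0r.
by move=> -> -> ->.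
Qed.

Lemma eval_conic_poly a b c d e g (x : 'cV[K]_2) :
  eval_at (conic_poly a b c d e g) x =
    a * x 0 0 ^+ 2 + b * x 1 0 ^+ 2 + c * (x 0 0 * x 1 0)
      + d * x 0 0 + e * x 1 0 + g.
Proof.
rewrite /eval_at /conic_poly !mevalD !mevalZ mevalC !mevalM !mevalXU.
rewrite -!expr2 //.
have -> : (ord_max : 'I_2) = 1 by apply: val_inj.
by [].
Qed.

Lemma scale_conic_poly k a b c d e g :
  k *: conic_poly a b c d e g =
  conic_poly (k * a) (k * b) (k * c) (k * d) (k * e) (k * g).
Proof.
apply/mpolyP => n; rewrite mcoeffZ !mcoeff_conic_poly.
by rewrite !mulrDr !mulrnAr.
Qed.

Lemma sqr_conic_poly (a b : K) :
  (a *: 'X_ord0 + b *: 'X_ord_max) ^+ 2 =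
  conic_poly (a ^+ 2) (b ^+ 2) (2 * a * b) 0 0 0.
Proof.
rewrite /conic_poly mpolyC0 !scale0r !addr0 sqrrD !exprZn -scalerAl -scalerAr.
by rewrite scalerA -scaler_nat scalerA mulrA addrAC.
Qed.

End ConicPolynomials.

(** Dividing by the coefficient of x^2, or of y^2 if the former vanishes, leaves (x + b y)^2 or y^2.
    Whether the quadratic part is real up to a factor can then be read off [b] alone. *)
Lemma parabolaE (K : fieldType) (q : {mpoly K[2]}) : parabola q ->
  exists k d e g, k != 0 /\
    (q = k *: conic_poly 0 1 0 d e g \/
     exists b, q = k *: conic_poly 1 (b ^+ 2) (2 * b) d e g).
Proof.
case=> cq [k [a [b [k0 ab0 qE]]]].
have [|a' [b' [c' [d [e [g qE']]]]]] := @conic_polyE _ q; first by rewrite cq.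
have {qE'}qE : q = conic_poly (k * a ^+ 2) (k * b ^+ 2) (k * (2 * a * b)) d e g.
  rewrite qE'; apply/mpolyP => n; have := congr1 (mcoeff n) qE.
  rewrite qE' quad_part_conic_poly sqr_conic_poly scale_conic_poly !mulr0.
  by rewrite !mcoeff_conic_poly !mul0rn !addr0 => ->.
have [a0|a0] := eqVneq a 0.
  have b0 : b != 0 by apply: contraNneq ab0 => ->; rewrite a0.
  have k1 : k * b ^+ 2 != 0 by rewrite mulf_neq0 // expf_neq0.
  exists (k * b ^+ 2), (d / (k * b ^+ 2)), (e / (k * b ^+ 2)), (g / (k * b ^+ 2)).
  split=> //; left; rewrite scale_conic_poly ![_ * (_ / _)]mulrC !mulfVK // qE.
  by rewrite a0 expr0n !mulr0 mul0r mulr1 mulr0.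
have k1 : k * a ^+ 2 != 0 by rewrite mulf_neq0 // expf_neq0.
exists (k * a ^+ 2), (d / (k * a ^+ 2)), (e / (k * a ^+ 2)), (g / (k * a ^+ 2)).
split=> //; right; exists (b / a); rewrite scale_conic_poly qE mulr1.
have -> : k * a ^+ 2 * (b / a) ^+ 2 = k * b ^+ 2 by field.
have -> : k * a ^+ 2 * (2 * (b / a)) = k * (2 * a * b) by field.
by rewrite ![_ * (_ / (_ * _))]mulrC !mulfVK.
Qed.

(** * Planar configurations and Gale duality *)

Section Configuration.
Variables (R : realType) (N : nat).

Lemma det2 (u v : 'cV[R]_2) :
  \det (row_mx u v : 'M[R]_2) = u 0 0 * v 1 0 - u 1 0 * v 0 0.
Proof.
rewrite (expand_det_row _ 0) !big_ord_recl big_ord0 /cofactor !det_mx11 !mxE /=.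
have s0 i : split (i : 'I_(1 + 1)) = if i == ord0 then inl 0 else inr 0.
  case: (splitP (m := 1) (n := 1) i) => k ik; rewrite [k]ord1 in ik *.
    by rewrite -val_eqE /= ik.
  by rewrite -val_eqE /= ik.
rewrite !s0 /=; have -> : lift 0 0 = 1 :> 'I_2 by apply: val_inj.
by rewrite /bump /= expr0 expr1; ring.
Qed.

(** Passing to all ordered pairs turns the double sum into products of simple sums. *)
Lemma sum_ltn_sym (g : 'I_N -> 'I_N -> R) :
  (forall k l, g k l = g l k) -> (forall k, g k k = 0) ->
  \sum_(k < N) \sum_(l < N) g k l =
    2 * \sum_(k < N) \sum_(l < N | (k < l)%N) g k l.
Proof.
move=> gC g0; rewrite mulr_natl mulr2n.
have -> : \sum_(k < N) \sum_(l < N) g k l =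
    \sum_(k < N) (\sum_(l < N | (k < l)%N) g k l + \sum_(l < N | (l < k)%N) g k l).
  apply: eq_bigr => k _; rewrite (bigID (fun l : 'I_N => (k < l)%N)) /=.
  congr (_ + _); rewrite (bigD1 k) ?ltnn //= g0 add0r; apply: eq_bigl => l.
  by rewrite -leqNgt ltn_neqAle andbC.
rewrite big_split /=; congr (_ + _); rewrite (exchange_big_dep xpredT) //=.
by apply: eq_bigr => k _; apply: eq_bigr => l _; exact: gC.
Qed.

(** * Quadratic relations through the Gale dual *)

Definition gale_form m (B : 'M[R]_(N, m)) (f : 'I_N -> R) : 'rV[R]_m :=
  (\row_k f k) *m B.

Lemma lform_gale_form m (B : 'M[R]_(N, m)) f t :
  lform (gale_form B f) t = \sum_k f k * (B *m t) k 0.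
Proof.
by rewrite /lform -mulmxA mxE; apply: eq_bigr => k _; rewrite mxE.
Qed.

Variable A : 'M[R]_(3, N).

Definition sqr_x k := point A k 0 0 ^+ 2.
Definition sqr_y k := point A k 1 0 ^+ 2.
Definition mul_xy k := point A k 0 0 * point A k 1 0.

(** This is Lagrange's identity with weights w = B t: the squared determinant expands into x_k^2
    y_l^2 + y_k^2 x_l^2 - 2 x_k y_k x_l y_l. *)
Lemma cuspidal_formE m (B : 'M[R]_(N, m)) t :
  cuspidal_form A B t =
    lform (gale_form B sqr_x) t * lform (gale_form B sqr_y) t
      - lform (gale_form B mul_xy) t ^+ 2.
Proof.
rewrite !lform_gale_form; set w := B *m t.
have wE k : w k 0 = \sum_(i < m) B k i * t i 0 by rewrite mxE.
pose g k l := \det (row_mx (point A k) (point A l) : 'M[R]_2) ^+ 2 * w k 0 * w l 0.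
have gC k l : g k l = g l k by rewrite /g !det2; ring.
have g0 k : g k k = 0 by rewrite /g det2; ring.
have two0 : 2 != 0 :> R by rewrite pnatr_eq0.
apply: (mulfI two0); transitivity (2 * \sum_(k < N) \sum_(l < N | (k < l)%N) g k l).
  congr (_ * _); apply: eq_bigr => k _; apply: eq_bigr => l _.
  by rewrite /g !wE.
rewrite -sum_ltn_sym //.
have -> : 2 * ((\sum_k sqr_x k * w k 0) * (\sum_k sqr_y k * w k 0)
    - (\sum_k mul_xy k * w k 0) ^+ 2) =
    (\sum_k sqr_x k * w k 0) * (\sum_k sqr_y k * w k 0)
    + (\sum_k sqr_y k * w k 0) * (\sum_k sqr_x k * w k 0)
    - 2 * ((\sum_k mul_xy k * w k 0) * (\sum_k mul_xy k * w k 0)) by ring.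
rewrite !big_distrlr /= mulr_sumr -sumrN -!big_split /=; apply: eq_bigr => k _.
rewrite mulr_sumr -sumrN -!big_split /=; apply: eq_bigr => l _.
by rewrite /g det2 /sqr_x /sqr_y /mul_xy; ring.
Qed.

Hypothesis hA : planar_config A.

Lemma config_rowE (u : 'rV[R]_3) k :
  (u *m A) 0 k = u 0 0 + u 0 (lift ord0 0) * point A k 0 0
    + u 0 (lift ord0 1) * point A k 1 0.
Proof.
rewrite mxE !big_ord_recl big_ord0 addr0 hA.2 mulr1 addrA !mxE.
by congr (_ + _ + _ * _); congr (_ _ _ _); apply: val_inj.
Qed.

Lemma config_row c0 c1 c2 : exists u : 'rV[R]_3,
  [/\ u 0 0 = c0, u 0 (lift ord0 0) = c1, u 0 (lift ord0 1) = c2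
    & forall k, (u *m A) 0 k = c0 + c1 * point A k 0 0 + c2 * point A k 1 0].
Proof.
exists (\row_i [:: c0; c1; c2]`_i); split; rewrite ?mxE // => k.
by rewrite config_rowE 3![(\row__ _) _ _]mxE.
Qed.

(** Rank three means that the points are not collinear. *)
Lemma affine_eq0 c0 c1 c2 :
  (forall k, c0 + c1 * point A k 0 0 + c2 * point A k 1 0 = 0) ->
  [/\ c0 = 0, c1 = 0 & c2 = 0].
Proof.
move=> E; have [u [u0 u1 u2 uA]] := config_row c0 c1 c2.
have Af : row_free A by rewrite /row_free hA.1.
have uz : u = 0.
  by apply: (row_free_inj Af); rewrite mul0mx; apply/rowP => k; rewrite uA E mxE.
by rewrite -u0 -u1 -u2 uz !mxE.
Qed.

Variables (m : nat) (B : 'M[R]_(N, m)).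
Hypotheses (hm : m = (N - 3)%N) (hB : gale_dual A B).

Lemma config_size : (3 <= N)%N.
Proof. by rewrite -hA.1 rank_leq_col. Qed.

(** The row space of [A] lies in the left kernel of [B], and both have dimension 3 = N - m, so they
    coincide. *)
Lemma gale_annihilator r (F : 'M[R]_(r, N)) : F *m B = 0 -> (F <= A)%MS.
Proof.
move=> FB; have AK : (A <= kermx B)%MS by apply/sub_kermxP/hB.2.
have := mxrank_leqif_sup AK; rewrite mxrank_ker hB.1 hA.1.
have -> : (N - m = 3)%N by rewrite hm subKn ?config_size.
move=> [_ /esym]; rewrite eqxx => KA; apply: submx_trans KA.
exact/sub_kermxP.
Qed.

Notation X := (gale_form B sqr_x).
Notation Y := (gale_form B sqr_y).
Notation Z := (gale_form B mul_xy).

Lemma gale_relationE a b c :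
  a *: X + b *: Y + c *: Z =
    gale_form B (fun k => a * sqr_x k + b * sqr_y k + c * mul_xy k).
Proof.
rewrite /gale_form !scalemxAl -!mulmxDl; congr (_ *m _); apply/rowP => k.
by rewrite !mxE.
Qed.

Lemma gale_form_eq0 f : gale_form B f = 0 <->
  exists d e g, forall k, f k + d * point A k 0 0 + e * point A k 1 0 + g = 0.
Proof.
split=> [/gale_annihilator/submxP[u fE]|[d [e [g fE]]]].
  exists (- u 0 (lift ord0 0)), (- u 0 (lift ord0 1)), (- u 0 0) => k.
  by have /rowP/(_ k) := fE; rewrite config_rowE [(\row__ _) _ _]mxE => ->; ring.
have [u [_ _ _ uE]] := config_row (- g) (- d) (- e).
rewrite /gale_form; have -> : \row_k f k = u *m A.
  by apply/rowP => k; rewrite uE [LHS]mxE; have := fE k; lra.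
by rewrite -mulmxA hB.2 mulmx0.
Qed.

Lemma gale_relationP a b c : a *: X + b *: Y + c *: Z = 0 <->
  exists d e g, forall k, a * sqr_x k + b * sqr_y k + c * mul_xy k
    + d * point A k 0 0 + e * point A k 1 0 + g = 0.
Proof. by rewrite gale_relationE gale_form_eq0. Qed.

(** * Pyramids and the vanishing of the cuspidal form *)

Lemma pyramid_form0 t : pyramid A -> cuspidal_form A B t = 0.
Proof.
case=> j [a [b [c [ab0 line]]]]; rewrite cuspidal_formE.
set x0 := point A j 0 0; set y0 := point A j 1 0.
(* The line through the base, times each of the lines x = x0 and y = y0 through the apex, vanishes
   at every point. These two degenerate conics give a X + b Z = 0 and b Y + a Z = 0, which force X Y
   - Z^2 = 0 because (a, b) is nonzero. *)
have lx k : (a * point A k 0 0 + b * point A k 1 0 + c) * (point A k 0 0 - x0) = 0.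
  have [->|/line ->] := eqVneq (point A k) (point A j); last by rewrite mul0r.
  by rewrite subrr mulr0.
have ly k : (a * point A k 0 0 + b * point A k 1 0 + c) * (point A k 1 0 - y0) = 0.
  have [->|/line ->] := eqVneq (point A k) (point A j); last by rewrite mul0r.
  by rewrite subrr mulr0.
have /(lform_relation t) e1 : a *: X + 0 *: Y + b *: Z = 0.
  apply/gale_relationP; exists (c - a * x0), (- b * x0), (- c * x0) => k.
  by rewrite -[RHS](lx k) /sqr_x /sqr_y /mul_xy; ring.
have /(lform_relation t) e2 : 0 *: X + b *: Y + a *: Z = 0.
  apply/gale_relationP; exists (- a * y0), (c - b * y0), (- c * y0) => k.
  by rewrite -[RHS](ly k) /sqr_x /sqr_y /mul_xy; ring.
move: e1 e2; set x := lform X t; set y := lform Y t; set z := lform Z t => e1 e2.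
have aE : a * (x * y - z ^+ 2) = 0.
  transitivity ((a * x + 0 * y + b * z) * y - z * (0 * x + b * y + a * z)).
    by ring.
  by rewrite e1 e2 mul0r mulr0 subr0.
have bE : b * (x * y - z ^+ 2) = 0.
  transitivity (x * (0 * x + b * y + a * z) - z * (a * x + 0 * y + b * z)).
    by ring.
  by rewrite e1 e2 !mulr0 subr0.
move: ab0; rewrite xpair_eqE negb_and => /orP[] n0.
  by move/eqP: aE; rewrite mulf_eq0 (negPf n0) => /eqP.
by move/eqP: bE; rewrite mulf_eq0 (negPf n0) => /eqP.
Qed.

(* For a linear form [l] such that [l * x] and [l * y] are affine on the points,
   the columns (1, x, y) of [A] are eigenvectors, with eigenvalues [l], of one
   3 x 3 matrix [G].  Read in a basis of three columns, [G] is diagonal and not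
   scalar, so one of the three eigenvalues is simple. *)
Lemma pyramid_of_form0 : (forall t, cuspidal_form A B t = 0) -> pyramid A.
Proof.
move=> P0; have [p [q [pq0 qX qZ]]] : exists p q : R,
    [/\ (p, q) != (0, 0), q *: X = p *: Z & q *: Z = p *: Y].
  by apply: isotropic_forms => t; rewrite -cuspidal_formE.
(* This choice makes l x = q x^2 - p x y and l y = q x y - p y^2, whose Gale forms q X - p Z and q Z
   - p Y vanish: both products are affine on the points. *)
pose l k := q * point A k 0 0 - p * point A k 1 0.
have lB : (A *m diag_mx (\row_k l k)) *m B = 0.
  have rel a b c : a *: X + b *: Y + c *: Z = 0 ->
      (\row_k (a * sqr_x k + b * sqr_y k + c * mul_xy k)) *m B = 0.
    by rewrite gale_relationE.
  apply/row_matrixP => i; rewrite row_mul row0.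
  have rowE : row i (A *m diag_mx (\row_k l k)) = \row_k (A i k * l k).
    by apply/rowP => k; rewrite mul_mx_diag !mxE.
  rewrite rowE; case: (unliftP ord0 i) => [{rowE}i ->|->]; last first.
    apply/gale_form_eq0; exists (- q), p, 0 => k.
    by rewrite hA.2 /l; ring.
  have -> : \row_k (A (lift ord0 i) k * l k) = \row_k (point A k i 0 * l k).
    by apply/rowP => k; rewrite !mxE.
  case: i => -[|[|//]] lti.
    rewrite -[RHS](rel q 0 (- p)); last by rewrite scale0r addr0 qX scaleNr subrr.
    congr (_ *m _); apply/rowP => k; rewrite [LHS]mxE [RHS]mxE /l /sqr_x /mul_xy.
    have -> : Ordinal lti = 0 by apply: val_inj.
    ring.
  rewrite -[RHS](rel 0 (- p) q); last first.
    by rewrite scale0r add0r qZ scaleNr addNr.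
  congr (_ *m _); apply/rowP => k; rewrite [LHS]mxE [RHS]mxE /l /sqr_y /mul_xy.
  have -> : Ordinal lti = 1 by apply: val_inj.
  ring.
have /submxP[G GE] := gale_annihilator lB.
have Afull : row_full A^T by rewrite /row_full mxrank_tr hA.1.
pose f := fullrankfun Afull.
pose V := (rowsub f A^T)^T.
have Vu : V \in unitmx.
  by rewrite unitmx_tr -row_full_unit fullrowsub_full.
have colV i : col i V = col (f i) A by apply/colP => j; rewrite !mxE.
have [C CV] : exists C, C = invmx V *m A by exists (invmx V *m A).
have VC : V *m C = A by rewrite CV mulKVmx.
have GV : G *m V = V *m diag_mx (\row_i l (f i)).
  apply/matrixP => j i.
  have /matrixP/(_ j (f i)) := GE; rewrite mul_mx_diag [LHS]mxE => E.
  rewrite mul_mx_diag [RHS]mxE.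
  have -> : V j i = A j (f i) by rewrite !mxE.
  move: E; rewrite ![(\row__ _) _ _]mxE => ->.
  by rewrite !mxE; apply: eq_bigr => k _; rewrite !mxE.
have CE i k : C i k * l k = l (f i) * C i k.
  have : V *m (C *m diag_mx (\row_k l k)) = V *m (diag_mx (\row_i l (f i)) *m C).
    by rewrite !mulmxA VC -GV -mulmxA VC GE.
  move/(congr1 (mulmx (invmx V))); rewrite !mulKmx // => /matrixP/(_ i k).
  by rewrite mul_mx_diag mul_diag_mx [LHS]mxE [RHS]mxE ![(\row__ _) _ _]mxE.
have Cf i j : C i (f j) = (i == j)%:R.
  have : C *m delta_mx (f j) 0 = invmx V *m (V *m delta_mx j 0) :> 'cV_3.
    by rewrite CV -mulmxA -!colE colV.
  by rewrite mulKmx // => /colP/(_ i); rewrite -colE !mxE andbT.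
(* The three eigenvalues are not all equal, since otherwise a nonconstant affine function would
   vanish at three independent columns. Hence one of them differs from the two others. *)
have [i0 i0P] : exists i0, forall i, i != i0 -> l (f i) != l (f i0).
  have nconst : ~ (forall i, l (f i) = l (f 0)).
    move=> lc; pose u : 'rV[R]_3 := \row_i [:: - l (f 0); q; - p]`_i.
    have uV : u *m V = 0.
      apply/rowP => i; have -> : (u *m V) 0 i = (u *m A) 0 (f i).
        by rewrite !mxE; apply: eq_bigr => k _; rewrite !mxE.
      rewrite config_rowE ![(\row__ _) _ _]mxE /= [RHS]mxE -(lc i) /l; ring.
    have u0 : u = 0 by rewrite -[u](mulmxK Vu) uV mul0mx.
    move/eqP: pq0; apply; congr (_, _).
      have /rowP/(_ (lift ord0 1)) := u0; rewrite !mxE /= => /eqP.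
      by rewrite oppr_eq0 => /eqP.
    by have /rowP/(_ (lift ord0 0)) := u0; rewrite !mxE.
  pose i1 : 'I_3 := lift ord0 0; pose i2 : 'I_3 := lift ord0 1.
  have case3 (Q : 'I_3 -> Prop) : Q 0 -> Q i1 -> Q i2 -> forall i, Q i.
    move=> Q0 Q1 Q2; case=> -[|[|[|//]]] lti.
    - by rewrite (_ : Ordinal lti = 0) //; apply: val_inj.
    - by rewrite (_ : Ordinal lti = i1) //; apply: val_inj.
    - by rewrite (_ : Ordinal lti = i2) //; apply: val_inj.
  have [e01|n01] := eqVneq (l (f i1)) (l (f 0)).
    have n20 : l (f i2) != l (f 0).
      apply/eqP => e02; apply: nconst.
      exact: (case3 (fun i => l (f i) = l (f 0))).
    exists i2; apply: (case3 (fun i => i != i2 -> l (f i) != l (f i2))).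
    - by rewrite [l _ == _]eq_sym.
    - by rewrite e01 [l _ == _]eq_sym.
    - by rewrite eqxx.
  have [e02|n02] := eqVneq (l (f i2)) (l (f 0)).
    exists i1; apply: (case3 (fun i => i != i1 -> l (f i) != l (f i1))).
    - by rewrite [l _ == _]eq_sym.
    - by rewrite eqxx.
    - by rewrite e02 [l _ == _]eq_sym.
  exists 0; apply: (case3 (fun i => i != 0 -> l (f i) != l (f 0))) => [/eqP|_|_] //.
have CA i k : C i k = invmx V i 0 + invmx V i (lift ord0 0) * point A k 0 0
    + invmx V i (lift ord0 1) * point A k 1 0.
  have -> : C i k = (row i (invmx V) *m A) 0 k by rewrite -row_mul -CV mxE.
  by rewrite config_rowE ![row _ _ _ _]mxE.
(* The apex is the basis point [f i0], and the line joins the two other basis points: it is the zero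
   set of the affine coordinate [C i0]. A column off this line has eigenvalue [l (f i0)], so its
   other coordinates vanish and it is a multiple of the apex column; the top row of ones makes the
   factor 1. *)
exists (f i0), (invmx V i0 (lift ord0 0)), (invmx V i0 (lift ord0 1)),
  (invmx V i0 0); split.
  apply/eqP => -[e1 e2].
  have [i ii0] : exists i, i != i0.
    have [->|] := eqVneq i0 0; last by exists 0; rewrite eq_sym.
    by exists (lift ord0 0).
  have := Cf i0 i0; have := Cf i0 i; rewrite !CA e1 e2 !mul0r !addr0 eqxx.
  by rewrite eq_sym (negPf ii0) => -> /eqP; rewrite eq_sym oner_eq0.
move=> k kf; have [C0|C0] := eqVneq (C i0 k) 0.
  by rewrite -[RHS]C0 CA; ring.
case/eqP: kf.
have lk : l k = l (f i0) by apply: (mulfI C0); rewrite CE mulrC.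
have Ci i : i != i0 -> C i k = 0.
  move=> /i0P li; apply/eqP; move/eqP: (CE i k).
  rewrite lk mulrC -subr_eq0 -mulrBl mulf_eq0 subr_eq0 eq_sym (negPf li) /=.
  by [].
have Ak j : A j k = A j (f i0) * C i0 k.
  rewrite -[in LHS]VC mxE (bigD1 i0) //= big1 ?addr0.
    by rewrite [V _ _]mxE [rowsub _ _ _ _]mxE mxE.
  by move=> i /Ci ->; rewrite mulr0.
have C1 : C i0 k = 1 by have := Ak 0; rewrite !hA.2 mul1r.
by apply/colP => i; rewrite !mxE Ak C1 mulr1.
Qed.

(** * Incidence with real and complex conics *)

Lemma lies_on_conic_poly a b c d e g :
  lies_on A (conic_poly a b c d e g) <->
  forall k, a * sqr_x k + b * sqr_y k + c * mul_xy k
    + d * point A k 0 0 + e * point A k 1 0 + g = 0.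
Proof. by split=> E k; have := E k; rewrite eval_conic_poly. Qed.

Lemma complex_combination (a b c d e g : R[i]) (x y : R) :
  a * x%:C%C ^+ 2 + b * y%:C%C ^+ 2 + c * (x%:C%C * y%:C%C)
    + d * x%:C%C + e * y%:C%C + g =
  Complex (complex.Re a * x ^+ 2 + complex.Re b * y ^+ 2 + complex.Re c * (x * y)
             + complex.Re d * x + complex.Re e * y + complex.Re g)
          (complex.Im a * x ^+ 2 + complex.Im b * y ^+ 2 + complex.Im c * (x * y)
             + complex.Im d * x + complex.Im e * y + complex.Im g).
Proof.
case: a b c d e g => [a1 a2] [b1 b2] [c1 c2] [d1 d2] [e1 e2] [g1 g2].
by apply/eqP; rewrite eq_complex /=; apply/andP; split; apply/eqP; ring.
Qed.

Lemma lies_on_complex_conic_poly a b c d e g :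
  lies_on_complex A (conic_poly a b c d e g) <->
  lies_on A (conic_poly (complex.Re a) (complex.Re b) (complex.Re c)
               (complex.Re d) (complex.Re e) (complex.Re g)) /\
  lies_on A (conic_poly (complex.Im a) (complex.Im b) (complex.Im c)
               (complex.Im d) (complex.Im e) (complex.Im g)).
Proof.
rewrite !lies_on_conic_poly; split=> [E|[E1 E2] k]; last first.
  rewrite eval_conic_poly ![map_mx _ _ _ _]mxE complex_combination.
  by rewrite -/(sqr_x k) -/(sqr_y k) -/(mul_xy k) E1 E2.
by split=> k; have := E k;
  rewrite eval_conic_poly ![map_mx _ _ _ _]mxE complex_combination => -[].
Qed.

Lemma map_conic_poly (a b c d e g : R) :
  map_mpoly (real_complex R) (conic_poly a b c d e g) =
  conic_poly a%:C%C b%:C%C c%:C%C d%:C%C e%:C%C g%:C%C.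
Proof.
apply/mpolyP => k; rewrite mcoeff_map_mpoly !mcoeff_conic_poly.
by rewrite !raddfD !raddfMn.
Qed.

Lemma complex_real (z : R[i]) : complex.Im z = 0 -> z = (complex.Re z)%:C%C.
Proof. by case: z => x y /= ->. Qed.

(** With a real quadratic part, the imaginary part of the equation is affine; it vanishes at
    noncollinear points, hence identically. *)
Lemma proportional_to_realI k (a b c : R) d e g : k != 0 ->
  lies_on_complex A (k *: conic_poly a%:C%C b%:C%C c%:C%C d e g) ->
  proportional_to_real (k *: conic_poly a%:C%C b%:C%C c%:C%C d e g).
Proof.
move=> k0 on.
have /lies_on_complex_conic_poly[_ /lies_on_conic_poly /= imE] :
    lies_on_complex A (conic_poly a%:C%C b%:C%C c%:C%C d e g).
  move=> j; have := on j; rewrite /eval_at mevalZ => /eqP.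
  by rewrite mulf_eq0 (negPf k0) => /eqP.
have [j|g0 d0 e0] := @affine_eq0 (complex.Im g) (complex.Im d) (complex.Im e).
  by rewrite -[RHS](imE j); ring.
exists k, (conic_poly a b c (complex.Re d) (complex.Re e) (complex.Re g)).
split=> //; rewrite map_conic_poly.
by rewrite -(complex_real d0) -(complex_real e0) -(complex_real g0).
Qed.

Lemma nonreal_parabolaE : in_nonreal_parabola A ->
  exists b d e g, complex.Im b != 0 /\
    lies_on_complex A (conic_poly 1 (b ^+ 2) (2 * b) d e g).
Proof.
case=> q [/parabolaE[k [d [e [g [k0 qE]]]]] nreal on].
have imb a b c : q = k *: conic_poly a b c d e g ->
    complex.Im a = 0 -> complex.Im b = 0 -> complex.Im c = 0 -> False.
  move=> qE' /complex_real aE /complex_real bE /complex_real cE; apply: nreal.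
  by move: on; rewrite qE' aE bE cE; apply: proportional_to_realI.
case: qE => [qE|[b qE]]; first by case: (imb _ _ _ qE).
exists b, d, e, g; split.
  apply/eqP => /complex_real bE; case: (imb _ _ _ qE) => //; rewrite bE.
    by rewrite -rmorphXn.
  by rewrite -(rmorph_nat (real_complex R)) -rmorphM.
move=> j; have := on j; rewrite qE /eval_at mevalZ => /eqP.
by rewrite mulf_eq0 (negPf k0) => /eqP.
Qed.

Lemma real_parabolaE : in_real_parabola A ->
  exists a b : R, (a, b) != (0, 0) /\
    a ^+ 2 *: X + b ^+ 2 *: Y + (2 * a * b) *: Z = 0.
Proof.
case=> q [/parabolaE[k [d [e [g [k0 qE]]]]] [c [r [c0 rE]]] on].
have vanish a b c' : q = k *: conic_poly a b c' d e g ->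
    complex.Re a *: X + complex.Re b *: Y + complex.Re c' *: Z = 0.
  move=> qE'; apply/gale_relationP.
  exists (complex.Re d), (complex.Re e), (complex.Re g).
  apply/lies_on_conic_poly.
  apply: (iffLR (lies_on_complex_conic_poly a b c' d e g) _).1 => j.
  have := on j; rewrite qE' /eval_at mevalZ => /eqP.
  by rewrite mulf_eq0 (negPf k0) => /eqP.
case: qE => [qE|[b qE]].
  exists 0, 1; rewrite xpair_eqE oner_eq0 andbF; split=> //.
  by rewrite -[RHS](vanish _ _ _ qE) /= expr0n expr1n mulr0 mul0r.
(* Comparing the coefficients of x^2 and x y with those of the real polynomial [r] shows that 2 b is
   a quotient of real numbers. *)
have bE : b = (complex.Re b)%:C%C.
  have coef n := congr1 (mcoeff n) (etrans (esym rE) qE).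
  have := coef (U_(ord0) *+ 2)%MM; have := coef (U_(ord0) + U_(ord_max))%MM.
  rewrite !mcoeffZ !mcoeff_map_mpoly !mcoeff_conic_poly !mulmnE !mnmDE !mnmE /=.
  rewrite !mulr0n !mulr1n !addr0 !add0r.
  move: (r@__) (r@__) => r20 r11 e11 e20.
  have r20n0 : r20 != 0.
    apply: contraNneq k0 => r0; move: e20.
    by rewrite r0 rmorph0 mulr0 mulr1 => ->.
  have : 2 * b * r20%:C%C = r11%:C%C.
    apply: (mulfI c0); rewrite e11 mulrCA e20 mulr1 mulrC //.
  case: (b) => b1 b2 /(congr1 (@complex.Im R)) /= eqI.
  have : 2 * b2 * r20 = 0 by rewrite -[RHS]eqI; ring.
  move/eqP; rewrite !mulf_eq0 (negPf r20n0) orbF pnatr_eq0 /= => /eqP b20.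
  by rewrite /= b20.
have := vanish _ _ _ qE; rewrite bE -rmorphXn /= => rel.
exists 1, (complex.Re b); rewrite xpair_eqE oner_eq0; split=> //.
rewrite -[RHS]rel expr1n mulr1; congr (_ + _ *: _).
ring.
Qed.

Lemma in_parabolaI (a b : R[i]) : (a, b) != (0, 0) ->
  complex.Re (a ^+ 2) *: X + complex.Re (b ^+ 2) *: Y
    + complex.Re (2 * a * b) *: Z = 0 ->
  complex.Im (a ^+ 2) *: X + complex.Im (b ^+ 2) *: Y
    + complex.Im (2 * a * b) *: Z = 0 ->
  in_real_parabola A \/ in_nonreal_parabola A.
Proof.
move=> ab0 /gale_relationP[d1 [e1 [g1 on1]]] /gale_relationP[d2 [e2 [g2 on2]]].
pose q := conic_poly (a ^+ 2) (b ^+ 2) (2 * a * b)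
  (Complex d1 d2) (Complex e1 e2) (Complex g1 g2).
have on : lies_on_complex A q.
  by apply/lies_on_complex_conic_poly; rewrite !lies_on_conic_poly.
have par : parabola q.
  split; last first.
    exists 1, a, b; rewrite oner_neq0 scale1r sqr_conic_poly; split=> //.
    exact: quad_part_conic_poly.
  apply: conic_conic_poly; apply: contraNneq ab0 => -[/eqP + /eqP + _].
  by rewrite !expf_eq0 /= => /eqP -> /eqP ->.
by case: (boolp.EM (proportional_to_real q)) => qr; [left|right]; exists q.
Qed.

Lemma proportional_in_parabola : proportional_forms X Y Z ->
  in_real_parabola A \/ in_nonreal_parabola A.
Proof.
case=> l [r [s [p [XE YE ZE]]]].
have [a [b [ab0 abE]]] : exists a b : R[i], (a, b) != (0, 0) /\
    a ^+ 2 * r%:C%C + b ^+ 2 * s%:C%C + 2 * a * b * p%:C%C = 0.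
  have [->|r0] := eqVneq r 0.
    exists 1, 0; rewrite xpair_eqE oner_eq0; split=> //.
    by rewrite rmorph0 expr0n !mulr0 !mul0r !addr0.
  have rc0 : r%:C%C != 0 :> R[i] by rewrite eq_complex /= eqxx andbT.
  (* [w] is a complex square root of the reduced discriminant of r a^2 + 2 p a b + s b^2, which is
     solved for [a] with b = 1. *)
  pose w := sqrtc (p ^+ 2 - r * s)%:C%C.
  exists ((w - p%:C%C) / r%:C%C), 1; rewrite xpair_eqE oner_eq0 andbF; split=> //.
  apply: (mulfI rc0); rewrite mulr0.
  have -> : r%:C%C * (((w - p%:C%C) / r%:C%C) ^+ 2 * r%:C%C + 1 ^+ 2 * s%:C%C
      + 2 * ((w - p%:C%C) / r%:C%C) * 1 * p%:C%C) =
      w ^+ 2 - (p%:C%C ^+ 2 - r%:C%C * s%:C%C) by field.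
  by rewrite sqr_sqrtc rmorphB rmorphXn rmorphM subrr.
have combine (u v w : R) : u * r + v * s + w * p = 0 ->
    u *: X + v *: Y + w *: Z = 0.
  by move=> E; rewrite XE YE ZE !scalerA -!scalerDl E scale0r.
have ReIm (u v w : R[i]) : u * r%:C%C + v * s%:C%C + w * p%:C%C =
    Complex (complex.Re u * r + complex.Re v * s + complex.Re w * p)
      (complex.Im u * r + complex.Im v * s + complex.Im w * p).
  case: u v w => [u1 u2] [v1 v2] [w1 w2].
  by apply/eqP; rewrite eq_complex /=; apply/andP; split; apply/eqP; ring.
by move: abE; rewrite ReIm => -[e1 e2]; apply: (in_parabolaI ab0); apply: combine.
Qed.

(** * Signatures from real and complex relations *)

Lemma signature_nonreal_parabola : in_nonreal_parabola A -> ~ pyramid A ->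
  has_signature (cuspidal_form A B) 1 0 (m - 1).
Proof.
case/nonreal_parabolaE=> b [d [e [g [b0 on]]]] npyr.
move: (b) b0 on => [b1 b2] /= b20 /lies_on_complex_conic_poly[].
move=> /lies_on_conic_poly reR /lies_on_conic_poly imR.
have /lform_relation re := iffRL (gale_relationP _ _ _)
  (ex_intro _ _ (ex_intro _ _ (ex_intro _ _ reR))).
have /lform_relation im := iffRL (gale_relationP _ _ _)
  (ex_intro _ _ (ex_intro _ _ (ex_intro _ _ imR))).
have b2p : 0 < b2 ^+ 2 by rewrite exprn_even_gt0.
have := @has_signature_square _ _ (cuspidal_form A B) (b2 ^+ 2) Y.
rewrite b2p lt_gtF //; apply.
- by rewrite gt_eqF.
- move=> t; rewrite cuspidal_formE; move: (re t) (im t) => /=.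
  set x := lform X t; set y := lform Y t; set z := lform Z t => e1 e2.
  (* The imaginary part of the relation gives Z = - b1 Y; the real part then gives X = (b1^2 + b2^2)
     Y, so X Y - Z^2 = b2^2 Y^2. *)
  have zE : z = - b1 * y.
    apply: (mulfI b20); lra.
  have xE : x = (b1 ^+ 2 + b2 ^+ 2) * y by rewrite zE in e1; lra.
  by rewrite xE zE; ring.
- by move/pyramid_of_form0.
Qed.

(** On the tangent plane the form is minus a square: it equals - (b Y + a Z)^2 / a^2, or - (a X + b
    Z)^2 / b^2 when [a] vanishes. It is nonzero because the points do not form a pyramid. *)
Lemma signature_real_parabola : in_real_parabola A -> ~ pyramid A ->
  has_signature (cuspidal_form A B) 0 1 (m - 1).
Proof.
case/real_parabolaE=> a [b [ab0 /lform_relation rel]] npyr.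
have sq (u : 'rV[R]_m) c : c != 0 ->
    (forall t, cuspidal_form A B t = - c ^- 2 * lform u t ^+ 2) ->
    has_signature (cuspidal_form A B) 0 1 (m - 1).
  move=> c0 FE; have c2 : - c ^- 2 < 0.
    by rewrite oppr_lt0 invr_gt0 exprn_even_gt0.
  have := has_signature_square _ FE; rewrite c2 lt_gtF //; apply.
    by rewrite lt_eqF.
  by move/pyramid_of_form0.
have [a0|a0] := eqVneq a 0.
  have b0 : b != 0 by apply: contraNneq ab0 => ->; rewrite a0.
  apply: (sq (a *: X + b *: Z) b b0) => t; rewrite cuspidal_formE lformD !lformZ.
  have := rel t; set x := lform X t; set y := lform Y t; set z := lform Z t => E.
  have -> : y = - (a ^+ 2 * x + 2 * a * b * z) / b ^+ 2.
    have b20 : b ^+ 2 != 0 by rewrite expf_neq0.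
    apply: (mulfI b20); rewrite mulrCA divff // mulr1; lra.
  by field.
apply: (sq (b *: Y + a *: Z) a a0) => t; rewrite cuspidal_formE lformD !lformZ.
have := rel t; set x := lform X t; set y := lform Y t; set z := lform Z t => E.
have -> : x = - (b ^+ 2 * y + 2 * a * b * z) / a ^+ 2.
  have a20 : a ^+ 2 != 0 by rewrite expf_neq0.
  apply: (mulfI a20); rewrite mulrCA divff // mulr1; lra.
by field.
Qed.

Lemma signature_plane_conic a b c :
  a *: X + b *: Y + c *: Z = 0 -> 4 * a * b - c ^+ 2 != 0 ->
  ~ in_real_parabola A -> ~ in_nonreal_parabola A ->
  has_signature (cuspidal_form A B)
    (4 * a * b < c ^+ 2)%R (c ^+ 2 < 4 * a * b)%R.+1 (m - 2).
Proof.
move=> rel D0 nreal nnonreal.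
case: (signature_plane (cuspidal_formE B) rel D0) => //.
by case/proportional_in_parabola.
Qed.

Lemma square_relation_in_parabola (a b : R) : (a, b) != (0, 0) ->
  a ^+ 2 *: X + b ^+ 2 *: Y + (2 * a * b) *: Z = 0 ->
  in_real_parabola A \/ in_nonreal_parabola A.
Proof.
move=> ab0 rel; apply: (@in_parabolaI a%:C%C b%:C%C).
- by apply: contraNneq ab0 => -[-> ->].
- rewrite -[2](rmorph_nat (real_complex R)) -!rmorphM -!rmorphXn /=.
  by rewrite -[RHS]rel.
- rewrite -[2](rmorph_nat (real_complex R)) -!rmorphM -!rmorphXn /=.
  by rewrite !scale0r !addr0.
Qed.

(** * The number of distinct points on a non-real parabola *)

Lemma conj_relation (p q g u : R[i]) : u ^+ 2 + p * u + q * u^*%C + g = 0 ->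
  u^*%C ^+ 2 + p^*%C * u^*%C + q^*%C * u + g^*%C = 0.
Proof.
case: p q g u => [p1 p2] [q1 q2] [g1 g2] [u1 u2] /eqP.
rewrite eq_complex /= => /andP[/eqP e1 /eqP e2].
apply/eqP; rewrite eq_complex /=; apply/andP; split; apply/eqP.
  by rewrite -[RHS]e1; ring.
by rewrite -[RHS]oppr0 -[in RHS]e2; ring.
Qed.

(* On the parabola, z = x + b y satisfies z^2 + p z + q z^* + g = 0; eliminating
   z^* between this equation and its conjugate gives a quartic with root z. *)
Lemma nonreal_parabola_card : injective (point A) -> in_nonreal_parabola A ->
  (N <= 4)%N.
Proof.
move=> injA /nonreal_parabolaE[b [d [e [g [b0 on]]]]].
pose x k := (point A k 0 0)%:C%C; pose y k := (point A k 1 0)%:C%C.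
pose z k := x k + b * y k.
have injz : injective z.
  move=> j k zjk; apply: injA; move: (congr1 (@complex.Im R) zjk).
  move: (congr1 (@complex.Re R) zjk); rewrite /z /x /y.
  move: (b) b0 => [b1 b2] /= b20 e1 e2.
  have ey : point A j 1 0 = point A k 1 0 by apply: (mulfI b20); lra.
  apply/colP => i; case: (unliftP ord0 i) => [{}i ->|->]; last first.
    by move: e1; rewrite ey; lra.
  by rewrite ord1 (_ : lift _ _ = 1) //; apply: val_inj.
pose w := b - b^*%C.
have w0 : w != 0.
  rewrite /w; case: (b) b0 => b1 b2 /= b20; rewrite eq_complex /= negb_and.
  by apply/orP; right; apply: contraNneq b20; rewrite opprK => bb; lra.
(* Solving z = x + b y and its conjugate for x and y, with determinant [w] up to sign, rewrites d x
   + e y as p z + q times the conjugate of z. *)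
pose p := (e - d * b^*%C) / w; pose q := (d * b - e) / w.
have zE k : z k ^+ 2 + p * z k + q * (z k)^*%C + g = 0.
  have := on k; rewrite eval_conic_poly ![map_mx _ _ _ _]mxE -/(x k) -/(y k).
  have -> : (z k)^*%C = x k + b^*%C * y k.
    have xc : (x k)^*%C = x k by exact: conjc_real.
    have yc : (y k)^*%C = y k by exact: conjc_real.
    by rewrite -[in RHS]xc -[in RHS]yc /z rmorphD rmorphM.
  move=> <-; rewrite /z /p /q; rewrite /w in w0 *; field.
  exact: w0.
pose p' := p^*%C; pose q' := q^*%C; pose g' := g^*%C.
have conjE := @conj_relation p q g.
(* The conjugate equation is multiplied by q^2, and q times the conjugate of z is replaced by - (z^2
   + p z + g). The square of that term makes [F] monic of degree 4 even when q = 0. *)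
pose F := Poly [:: g ^+ 2 - p' * q * g + q ^+ 2 * g';
  2 * p * g - p' * q * p + q ^+ 2 * q'; p ^+ 2 + 2 * g - p' * q; 2 * p; 1].
have F0 : F != 0.
  apply/eqP => /polyP/(_ 4); rewrite coef_Poly coef0 /=.
  by apply/eqP; rewrite oner_neq0.
have Fz k : root F (z k).
  apply/rootP; rewrite horner_Poly /=.
  move: (zE k); move: (z k) => u e1; have e2 := conjE u e1; move: e2 e1.
  rewrite -/p' -/q' -/g'; move: (u^*%C) => v e2 e1.
  have qv : q * v = - (u ^+ 2 + p * u + g).
    by apply/eqP; rewrite -addr_eq0 -[X in _ == X]e1; apply/eqP; ring.
  transitivity (q ^+ 2 * (v ^+ 2 + p' * v + q' * u + g')); last by rewrite e2 mulr0.
  have -> : q ^+ 2 * (v ^+ 2 + p' * v + q' * u + g') =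
    (q * v) ^+ 2 + p' * q * (q * v) + q ^+ 2 * q' * u + q ^+ 2 * g' by ring.
  by rewrite qv; ring.
have := max_poly_roots (rs := [seq z k | k <- enum 'I_N]) F0.
rewrite size_map size_enum_ord map_inj_uniq // enum_uniq => /(_ _ isT) Nlt.
apply: leq_trans (Nlt _) (size_Poly _).
by apply/allP => _ /mapP[k _ ->].
Qed.

End Configuration.

(** * Discriminants of real conics *)

Section RealConics.
Variable R : realType.

Lemma eval_quad_part (a b c d e g : R) (u : 'cV[R]_2) :
  eval_at (quad_part (conic_poly a b c d e g)) u =
    a * u 0 0 ^+ 2 + b * u 1 0 ^+ 2 + c * (u 0 0 * u 1 0).
Proof. by rewrite quad_part_conic_poly eval_conic_poly !mul0r !addr0. Qed.

Definition vec2 (x y : R) : 'cV[R]_2 := \col_i (if i == 0 then x else y).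

Lemma vec2_0 x y : vec2 x y 0 0 = x. Proof. by rewrite mxE. Qed.
Lemma vec2_1 x y : vec2 x y 1 0 = y. Proof. by rewrite mxE. Qed.

Lemma vec2_eq0 (u : 'cV[R]_2) : u 0 0 = 0 -> u 1 0 = 0 -> u = 0.
Proof.
move=> u0 u1; apply/colP; case=> -[|[|//]] i; rewrite [RHS]mxE.
  by rewrite -[RHS]u0; congr (u _ _); apply: val_inj.
by rewrite -[RHS]u1; congr (u _ _); apply: val_inj.
Qed.

Lemma conic_polyR (q : {mpoly R[2]}) : conic q ->
  exists a b c d e g, q = conic_poly a b c d e g.
Proof. by move=> cq; apply: conic_polyE; rewrite cq. Qed.

(** If 4 a b >= c^2, completing the square shows that [a] times the quadratic part is nonnegative,
    so the part cannot take both signs; for a = 0 only b y^2 remains. *)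
Lemma hyperbola_disc (a b c d e g : R) :
  hyperbola (conic_poly a b c d e g) -> 4 * a * b < c ^+ 2.
Proof.
case=> _ _ [[u +] [v]]; rewrite !eval_quad_part.
move: (u 0 0) (u 1 0) (v 0 0) (v 1 0) => x y x' y' Qu Qv.
rewrite ltNge; apply/negP => D.
have [a0|a0] := eqVneq a 0.
  have c0 : c = 0.
    apply/eqP; rewrite -sqrf_eq0 eq_le sqr_ge0 andbT; move: D.
    by rewrite a0 mulr0 mul0r.
  move: Qu Qv; rewrite a0 c0 !mul0r !addr0 !add0r => Qu Qv.
  case: (leP 0 b) => b0; first by move: Qv; rewrite ltNge mulr_ge0 ?sqr_ge0.
  by move: Qu; rewrite ltNge mulr_le0_ge0 ?sqr_ge0 // ltW.
have sq s t : 0 <= a * (a * s ^+ 2 + b * t ^+ 2 + c * (s * t)).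
  have -> : a * (a * s ^+ 2 + b * t ^+ 2 + c * (s * t)) =
    (a * s + c / 2 * t) ^+ 2 + (4 * a * b - c ^+ 2) / 4 * t ^+ 2 by field.
  by rewrite addr_ge0 ?sqr_ge0 // mulr_ge0 ?sqr_ge0 // divr_ge0 // subr_ge0.
have := sq x y; have := sq x' y'.
case: (ltgtP a 0) a0 => // a0 _ s1 s2.
  by move: s2; rewrite leNgt nmulr_rlt0 // Qu.
by move: s1; rewrite leNgt pmulr_rlt0 // Qv.
Qed.

Lemma ellipse_disc (a b c d e g : R) :
  ellipse (conic_poly a b c d e g) -> c ^+ 2 < 4 * a * b.
Proof.
case=> _ def.
have v0 : vec2 1 0 != 0.
  apply/eqP => /colP/(_ 0); rewrite vec2_0 mxE; apply/eqP.
  by rewrite oner_eq0.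
have {def}pos (u : 'cV[R]_2) : u != 0 ->
    0 < a * (a * u 0 0 ^+ 2 + b * u 1 0 ^+ 2 + c * (u 0 0 * u 1 0)).
  case: def => def u0; have := def _ v0; have := def _ u0; rewrite !eval_quad_part.
    by rewrite vec2_0 vec2_1 expr1n expr0n !mulr0 mulr1 !addr0 => Qu a0; rewrite mulr_gt0.
  by rewrite vec2_0 vec2_1 expr1n expr0n !mulr0 mulr1 !addr0 => Qu a0; rewrite nmulr_rgt0.
have := pos _ v0; rewrite vec2_0 vec2_1 expr1n expr0n !mulr0 mulr1 !addr0 => a2.
have a0 : a != 0 by apply: contraTneq a2 => ->; rewrite mul0r ltxx.
(* At this vector the completed square (a x + (c/2) y)^2 vanishes, which isolates the
   discriminant. *)
have w0 : vec2 c (- 2 * a) != 0.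
  apply/eqP => /colP/(_ 1); rewrite vec2_1 mxE; apply/eqP.
  by rewrite mulf_neq0 // oppr_eq0 pnatr_eq0.
have := pos _ w0; rewrite vec2_0 vec2_1.
have -> : a * (a * c ^+ 2 + b * (- 2 * a) ^+ 2 + c * (c * (- 2 * a))) =
  (a * a) * (4 * a * b - c ^+ 2) by ring.
by rewrite pmulr_rgt0 // subr_gt0.
Qed.

Lemma disc_hyperbola (a b c d e g : R) : 4 * a * b < c ^+ 2 ->
  hyperbola (conic_poly a b c d e g).
Proof.
move=> D; have D0 : 4 * a * b - c ^+ 2 != 0 by rewrite lt_eqF ?subr_lt0.
split.
- apply: conic_conic_poly; apply: contraTneq D => -[-> -> ->].
  by rewrite !mulr0 expr0n ltxx.
- move=> u polar; have e0 := polar (vec2 1 0); have e1 := polar (vec2 0 1).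
  move: e0 e1; rewrite !eval_quad_part.
  rewrite ![(_ + vec2 _ _) _ _]mxE !vec2_0 !vec2_1.
  set x := u 0 0; set y := u 1 0 => e0 e1.
  (* Additivity at the two basis vectors says that the polar form kills [u]: a linear system of
     determinant 4 a b - c^2. *)
  have e0' : 2 * a * x + c * y = 0 by lra.
  have e1' : 2 * b * y + c * x = 0 by lra.
  apply: vec2_eq0; apply: (mulfI D0); rewrite mulr0.
    transitivity (2 * b * (2 * a * x + c * y) - c * (2 * b * y + c * x)).
      by rewrite -/x; ring.
    by rewrite e0' e1' !mulr0 subr0.
  transitivity (2 * a * (2 * b * y + c * x) - c * (2 * a * x + c * y)).
    by rewrite -/y; ring.
  by rewrite e0' e1' !mulr0 subr0.
have two (u v : 'cV[R]_2) : eval_at (quad_part (conic_poly a b c d e g)) u *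
    eval_at (quad_part (conic_poly a b c d e g)) v < 0 ->
    indefinite (eval_at (quad_part (conic_poly a b c d e g))).
  set Qu := eval_at _ u; set Qv := eval_at _ v => uv.
  have [Qu0|Qu0|Qu0] := ltgtP Qu 0; last by move: uv; rewrite Qu0 mul0r ltxx.
    by move: uv; rewrite nmulr_rlt0 // => Qv0; split; [exists v|exists u].
  by move: uv; rewrite pmulr_rlt0 // => Qv0; split; [exists u|exists v].
have [a0|a0] := eqVneq a 0; last first.
  apply: (two (vec2 1 0) (vec2 c (- 2 * a))).
  rewrite !eval_quad_part !vec2_0 !vec2_1.
  have -> : (a * 1 ^+ 2 + b * 0 ^+ 2 + c * (1 * 0)) *
    (a * c ^+ 2 + b * (- 2 * a) ^+ 2 + c * (c * (- 2 * a))) =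
    a ^+ 2 * (4 * a * b - c ^+ 2) by ring.
  by rewrite pmulr_rlt0 ?subr_lt0 // exprn_even_gt0.
have c0 : c != 0.
  by apply: contraTneq D => ->; rewrite a0 mulr0 mul0r expr0n ltxx.
(* With a = 0 the form is y (b y + c x); these two vectors give it the values c and - c. *)
apply: (two (vec2 (1 - b / c) 1) (vec2 (- 1 - b / c) 1)).
rewrite !eval_quad_part !vec2_0 !vec2_1 a0.
have -> : (0 * (1 - b / c) ^+ 2 + b * 1 ^+ 2 + c * ((1 - b / c) * 1)) *
   (0 * (- 1 - b / c) ^+ 2 + b * 1 ^+ 2 + c * ((- 1 - b / c) * 1)) = - c ^+ 2 by field.
by rewrite oppr_lt0 exprn_even_gt0.
Qed.

Lemma disc_ellipse (a b c d e g : R) : c ^+ 2 < 4 * a * b ->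
  ellipse (conic_poly a b c d e g).
Proof.
move=> D; have a0 : a != 0.
  by apply: contraTneq D => ->; rewrite mulr0 mul0r -leNgt sqr_ge0.
split.
  by apply: conic_conic_poly; apply: contraNneq a0 => -[->].
have pos (u : 'cV[R]_2) : u != 0 ->
    0 < a * eval_at (quad_part (conic_poly a b c d e g)) u.
  move=> u0; rewrite eval_quad_part; move: u0.
  have [u1|u1 _] := eqVneq (u 1 0) 0.
    rewrite u1 expr0n !mulr0 !addr0 => u0.
    have u00 : u 0 0 != 0 by apply: contraNneq u0 => u00; apply/eqP/vec2_eq0.
    by rewrite mulrA mulr_gt0 ?exprn_even_gt0 // -expr2 exprn_even_gt0.
  have -> : a * (a * u 0 0 ^+ 2 + b * u 1 0 ^+ 2 + c * (u 0 0 * u 1 0)) =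
    (a * u 0 0 + c / 2 * u 1 0) ^+ 2 + (4 * a * b - c ^+ 2) / 4 * u 1 0 ^+ 2 by field.
  rewrite ltr_wpDl ?sqr_ge0 // mulr_gt0 ?exprn_even_gt0 // divr_gt0 //.
  by rewrite subr_gt0.
case: (ltgtP a 0) a0 => // a0 _; [right|left] => u /pos.
  by rewrite nmulr_rgt0.
by rewrite pmulr_rgt0.
Qed.

End RealConics.

(** * Signatures from conics *)

Section Classification.
Variables (R : realType) (N m : nat) (A : 'M[R]_(3, N)) (B : 'M[R]_(N, m)).
Hypotheses (hA : planar_config A) (hm : m = (N - 3)%N) (hB : gale_dual A B).
Notation P := (cuspidal_form A B).

Lemma signature_hyperbola : in_hyperbola A ->
  ~ in_real_parabola A -> ~ in_nonreal_parabola A ->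
  has_signature P 1 1 (m - 2).
Proof.
case=> q [hq on] nr nn; have [cq _ _] := hq.
have [a [b [c [d [e [g qE]]]]]] := conic_polyR cq.
rewrite qE in hq on; have D := hyperbola_disc hq.
have rel : a *: gale_form B (sqr_x A) + b *: gale_form B (sqr_y A)
    + c *: gale_form B (mul_xy A) = 0.
  by apply/gale_relationP => //; exists d, e, g; apply/lies_on_conic_poly.
have D0 : 4 * a * b - c ^+ 2 != 0 by rewrite lt_eqF ?subr_lt0.
have := signature_plane_conic hA hm hB rel D0 nr nn.
by rewrite D (lt_gtF D).
Qed.

Lemma signature_ellipse : in_ellipse A ->
  ~ in_real_parabola A -> ~ in_nonreal_parabola A ->
  has_signature P 0 2 (m - 2).
Proof.
case=> q [hq on] nr nn; have [cq _] := hq.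
have [a [b [c [d [e [g qE]]]]]] := conic_polyR cq.
rewrite qE in hq on; have D := ellipse_disc hq.
have rel : a *: gale_form B (sqr_x A) + b *: gale_form B (sqr_y A)
    + c *: gale_form B (mul_xy A) = 0.
  by apply/gale_relationP => //; exists d, e, g; apply/lies_on_conic_poly.
have D0 : 4 * a * b - c ^+ 2 != 0 by rewrite gt_eqF ?subr_gt0.
have := signature_plane_conic hA hm hB rel D0 nr nn.
by rewrite D (lt_gtF D).
Qed.

(** Any relation between X, Y and Z is a conic through the points, whose discriminant makes it a
    hyperbola, an ellipse or a parabola. *)
Lemma signature_no_conic : ~ in_ellipse A -> ~ in_hyperbola A ->
  ~ in_real_parabola A -> ~ in_nonreal_parabola A ->
  has_signature P 1 2 (m - 3).
Proof.
move=> nell nhyp nr nn.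
case: (signature_space (cuspidal_formE A B)) => // -[a [b [c [abc0 rel]]]].
have [d [e [g on]]] := (gale_relationP hA hm hB a b c).1 rel.
have {}on : lies_on A (conic_poly a b c d e g) by apply/lies_on_conic_poly.
have [D|D|D] := ltgtP (4 * a * b) (c ^+ 2).
- by case: nhyp; exists (conic_poly a b c d e g); split=> //; apply: disc_hyperbola.
- by case: nell; exists (conic_poly a b c d e g); split=> //; apply: disc_ellipse.
have par u v : (u, v) != (0, 0) -> u ^+ 2 *: gale_form B (sqr_x A)
    + v ^+ 2 *: gale_form B (sqr_y A) + (2 * u * v) *: gale_form B (mul_xy A) = 0 -> False.
  by move=> uv0 /(square_relation_in_parabola hA hm hB uv0) [].
have [a0|a0] := eqVneq a 0.
  have c0 : c = 0 by apply/eqP; rewrite -sqrf_eq0 -D a0 mulr0 mul0r.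
  have b0 : b != 0 by apply: contraNneq abc0 => ->; rewrite a0 c0.
  case: (par 0 1); first by rewrite xpair_eqE oner_eq0 andbF.
  apply: (scalerI b0); rewrite scaler0 -[RHS]rel a0 c0 expr0n expr1n mulr0 mul0r.
  by rewrite !scale0r !add0r !addr0 scale1r.
(* When 4 a b = c^2, [a] times the relation has coefficients a^2, (c/2)^2 and 2 a (c/2). *)
case: (par a (c / 2)); first by rewrite xpair_eqE (negPf a0).
rewrite -[RHS](scaler0 _ a) -rel !scalerDr !scalerA.
have -> : (c / 2) ^+ 2 = a * b by rewrite expr_div_n -D; field.
by congr (_ + _ *: _); field.
Qed.

End Classification.

(* The cases are read in order, each one excluding the preceding ones: the same
   points may lie on conics of several types, and a pyramid always lies on real
   parabolas and hyperbolas.  The signature (1,0;0) is that of (ii) for distinct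
   columns, where m = 1; repeated columns only increase z, so it is (1,0;m-1)
   in general. *)
Theorem theorem8p1 (R : realType) (N m : nat) (A : 'M[R]_(3, N))
    (B : 'M[R]_(N, m)) (hA : planar_config A) (hm : m = (N - 3)%N)
    (hB : gale_dual A B) :
  let P := cuspidal_form A B in
  (* (i) *)
  (has_signature P 0 0 m <-> pyramid A) /\
  (* (ii) *)
  ((has_signature P 1 0 (m - 1) <->
      in_nonreal_parabola A /\ ~ pyramid A) /\
   (injective (point A) ->
    (has_signature P 1 0 0 <->
      in_nonreal_parabola A /\ ~ pyramid A))) /\
  (* (iii) *)
  (has_signature P 0 1 (m - 1) <->
     in_real_parabola A /\ ~ in_nonreal_parabola A /\ ~ pyramid A) /\
  (* (iv) *)
  (has_signature P 1 1 (m - 2) <->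
     in_hyperbola A /\
     ~ in_real_parabola A /\ ~ in_nonreal_parabola A /\ ~ pyramid A) /\
  (* (v) *)
  (has_signature P 0 2 (m - 2) <->
     in_ellipse A /\ ~ in_hyperbola A /\
     ~ in_real_parabola A /\ ~ in_nonreal_parabola A /\ ~ pyramid A) /\
  (* (vi) *)
  (has_signature P 1 2 (m - 3) <->
     ~ in_ellipse A /\ ~ in_hyperbola A /\
     ~ in_real_parabola A /\ ~ in_nonreal_parabola A /\ ~ pyramid A).
Proof.
move=> P.
have S1 : pyramid A -> has_signature P 0 0 m.
  by move=> pyr; apply: has_signature_zero => t; apply: pyramid_form0.
have S2 : in_nonreal_parabola A -> ~ pyramid A -> has_signature P 1 0 (m - 1).
  exact: signature_nonreal_parabola.
have S3 : in_real_parabola A -> ~ pyramid A -> has_signature P 0 1 (m - 1).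
  exact: signature_real_parabola.
have S4 := signature_hyperbola hA hm hB.
have S5 := signature_ellipse hA hm hB.
have S6 := signature_no_conic hA hm hB.
have excl p q z p' q' z' : (p, q) <> (p', q') ->
    has_signature P p q z -> has_signature P p' q' z' -> False.
  by move=> ne s s'; apply: ne; exact: has_signature_unique s s'.
have e12 : has_signature P 0 0 m -> has_signature P 1 0 (m - 1) -> False by exact: excl.
have e13 : has_signature P 0 0 m -> has_signature P 0 1 (m - 1) -> False by exact: excl.
have e14 : has_signature P 0 0 m -> has_signature P 1 1 (m - 2) -> False by exact: excl.
have e15 : has_signature P 0 0 m -> has_signature P 0 2 (m - 2) -> False by exact: excl.
have e16 : has_signature P 0 0 m -> has_signature P 1 2 (m - 3) -> False by exact: excl.
have e23 : has_signature P 1 0 (m - 1) -> has_signature P 0 1 (m - 1) -> False by exact: excl.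
have e24 : has_signature P 1 0 (m - 1) -> has_signature P 1 1 (m - 2) -> False by exact: excl.
have e25 : has_signature P 1 0 (m - 1) -> has_signature P 0 2 (m - 2) -> False by exact: excl.
have e26 : has_signature P 1 0 (m - 1) -> has_signature P 1 2 (m - 3) -> False by exact: excl.
have e34 : has_signature P 0 1 (m - 1) -> has_signature P 1 1 (m - 2) -> False by exact: excl.
have e35 : has_signature P 0 1 (m - 1) -> has_signature P 0 2 (m - 2) -> False by exact: excl.
have e36 : has_signature P 0 1 (m - 1) -> has_signature P 1 2 (m - 3) -> False by exact: excl.
have e45 : has_signature P 1 1 (m - 2) -> has_signature P 0 2 (m - 2) -> False by exact: excl.
have e46 : has_signature P 1 1 (m - 2) -> has_signature P 1 2 (m - 3) -> False by exact: excl.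
have e56 : has_signature P 0 2 (m - 2) -> has_signature P 1 2 (m - 3) -> False by exact: excl.
have E1 := boolp.EM (pyramid A); have E2 := boolp.EM (in_nonreal_parabola A).
have E3 := boolp.EM (in_real_parabola A); have E4 := boolp.EM (in_hyperbola A).
have E5 := boolp.EM (in_ellipse A).
(* Distinct points on a non-real parabola number at most 4, so m <= 1 and the zero count m - 1 is
   0. *)
have distinct : injective (point A) -> in_nonreal_parabola A -> ~ pyramid A ->
    has_signature P 1 0 0.
  move=> injA nn npyr; have s := S2 nn npyr.
  have N4 := nonreal_parabola_card hA injA nn.
  have m1 : (m <= 1)%N by rewrite hm leq_subLR.
  by move: s; rewrite (eqP (_ : m - 1 == 0)%N) // subn_eq0.
(* Conversely, the signature (1, 0; 0) forces m = 1. *)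
have total : has_signature P 1 0 0 -> has_signature P 1 0 (m - 1).
  by move=> s; have -> : (m - 1 = 0)%N by rewrite -(has_signature_total s).
move: S1 S2 S3 S4 S5 S6 e12 e13 e14 e15 e16 e23 e24 e25 e26 e34 e35 e36 e45 e46 e56.
move: E1 E2 E3 E4 E5 distinct total; clear.
tauto.
Qed.
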